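(* Let $H$ be a separable complex Hilbert space and let $A\in\mathcal{B}_p(H)$ with $2\le p<\infty$. Then $$\sup_{\theta\in\mathbb{R}}\frac{\Big|\,\|Re^2(e^{i\theta}A)\|_{p/2}-\|Im^2(e^{i\theta}A)\|_{p/2}\Big|}{2}\le w_p^2(A)-\frac14\|A^*A+AA^*\|_{p/2}\le\frac12\,w_{p/2}(A^2).$$
   Context: For $p>0$, $\mathcal{B}_p(H)$ is the $p$-Schatten class: the compact operators $A$ on $H$ with $\|A\|_p=\big(\sum_{i}s_i(A)^p\big)^{1/p}<\infty$, where $s_i(A)$ are the singular values of $A$. For $T\in\mathcal{B}(H)$, $Re(T)=\frac{T+T^*}{2}$, $Im(T)=\frac{T-T^*}{2i}$, and $Re^2(T)=(Re(T))^2$, $Im^2(T)=(Im(T))^2$. For $q\geq 1$ and $T\in\mathcal{B}_q(H)$, $w_q(T)=\sup_{\theta\in\mathbb{R}}\|Re(e^{i\theta}T)\|_q$; $w_p^2(A)$ means $(w_p(A))^2$. *)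

(* Defs.v *)
From HB Require Import structures.
From mathcomp Require Import all_boot all_order all_algebra.
From mathcomp Require Import complex.
From mathcomp Require Import all_classical all_reals all_analysis.

Set Implicit Arguments.
Unset Strict Implicit.
Unset Printing Implicit Defensive.

Import Order.TTheory GRing.Theory Num.Theory.
Import numFieldNormedType.Exports.

Local Open Scope classical_set_scope.
Local Open Scope ring_scope.
Local Open Scope complex_scope.

(* [inner] is linear in its first argument and conjugate-linear in its second
   one; completeness is inherited from [completeNormedModType]. *)
HB.mixin Record CompleteNormedModule_isHilbert (R : realType) (H : Type)
    of CompleteNormedModule R[i] H := {
  inner : {dot H for (@Num.conj R[i])} ;
  inner_norm : forall x : H, inner x x = `|x| ^+ 2
}.

#[short(type="hilbertType")]
HB.structure Definition Hilbert (R : realType) :=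
  { H of CompleteNormedModule_isHilbert R H & CompleteNormedModule R[i] H }.

Definition separable (T : topologicalType) : Prop :=
  exists2 D : set T, countable D & dense D.

Section operators.
Variables (R : realType) (H : hilbertType R).
Implicit Types (T : H -> H) (E : set H).

(* Operators are plain functions; linearity and compactness (hence
   boundedness) are required in [schatten_class] below. For T linear and
   bounded, the Riesz representation theorem provides exactly one z for every
   y; the default value 0 is then never used. *)
Definition adjoint T : H -> H :=
  fun y => xget 0 [set z | forall x, inner (T x) y = inner x z].

Definition re_op T : H -> H := 2^-1 \*: (T \+ adjoint T).

Definition im_op T : H -> H := (2 * 'i)^-1 \*: (T \- adjoint T).

Definition expi (t : R) : R[i] := cos t +i* sin t.

Definition compact_operator T : Prop :=
  precompact (T @` [set x | `|x| <= 1]).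

Definition lin_indep n (v : 'I_n -> H) : Prop :=
  forall c : 'I_n -> R[i], \sum_(k < n) c k *: v k = 0 -> forall k, c k = 0.

(* +oo for infinite-dimensional subspaces *)
Definition dim E : \bar R :=
  ereal_sup [set n%:R%:E | n in
    [set n | exists v : 'I_n -> H, lin_indep v /\ forall k, E (v k)]].

Definition eigenspace T (c : R[i]) : set H := [set x | T x = c *: x].

(* The singular values of T are the square roots of the eigenvalues of T^* T;
   this is the multiplicity of s > 0 among them, 0 if s is not one of them. *)
Definition singular_mult T (s : R) : \bar R :=
  dim (eigenspace (adjoint T \o T) (s ^+ 2)%:C).

(* The sum of s_i(T)^q over all i, where terms with the same value s > 0 are
   grouped together, and those with s_i(T) = 0 contribute nothing. *)
Definition schatten_norm (q : R) T : \bar R :=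
  ((\esum_(s in [set s : R | (0 < s)%R])
      (singular_mult T s * (s `^ q)%:E)) `^ q^-1)%E.

Definition schatten_class (q : R) T : Prop :=
  [/\ linear T, compact_operator T & (schatten_norm q T < +oo)%E].

Definition schatten_numrad (q : R) T : \bar R :=
  ereal_sup [set schatten_norm q (re_op (expi t \*: T)) | t in [set: R]].

End operators.

(* Main.v *)
Require Import Defs.
From HB Require Import structures.
From mathcomp Require Import all_boot all_order all_algebra.
From mathcomp Require Import complex finmap ring lra.
From mathcomp Require Import all_classical all_reals all_analysis.

Import Order.TTheory GRing.Theory Num.Theory.
Import numFieldNormedType.Exports.

(* Let q = p/2, let B and C be the real and imaginary parts of e^(it) A, and let
   D = A^*A + AA^*. Expanding,
     B^2 = Re(e^(2it) A^2)/2 + D/4   and   B^2 + C^2 = D/2,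
   and C is the real part of e^(i(t - pi/2)) A. Since |B^2|_q = |B|_p^2, both
   inequalities follow from the triangle inequality for the Schatten q-norm; D has
   finite norm because |A^*A|_q = |A|_p^2 and |AA^*|_q = |A^*|_p^2 = |A|_p^2.

   The Schatten norm is controlled through a variational formula: for T compact
   and q >= 1, |T|_q^q is the supremum of sum_k |<T e_k, f_k>|^q over finite
   orthonormal families e and f. This formula is visibly invariant under taking
   adjoints, and yields the triangle inequality by Minkowski's inequality for
   finite sums. *)

Local Open Scope classical_set_scope.
Local Open Scope ring_scope.

Set Implicit Arguments.
Unset Strict Implicit.

(** [adjoint] is defined by choice and [schatten_norm] through dimensions of eigenspaces, so neither
    has algebraic properties by construction. Operators are therefore carried together with an
    explicit adjoint [T'], from which linearity and the value of [adjoint] follow. To pass from the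
    norm to the sums over [e] and [f], no full eigenbasis is formed: for each [r > 0] finitely many
    singular vectors with singular values at least [r] are split off, the remainder has operator
    norm at most [r], and its contribution to a finite sum vanishes with [r]. Norms may be infinite,
    so inequalities between them are obtained by comparing real upper bounds; the finiteness of the
    norm of D is what allows its quarter to be moved from one side to the other. *)

Local Notation "x %:C" := (real_complex _ x).

(** * Convexity of power functions *)

Section powR_inequalities.
Variable R : realType.
Implicit Types q a b t : R.

(** The tangent line at 1 lies below the convex power function. For [q > 1] this is Young's
    inequality for the product [t * 1] with exponents [q] and [q / (q - 1)]. *)
Lemma powR_bernoulli q t : 1 <= q -> 0 <= t -> q * t - (q - 1) <= t `^ q.
Proof.
rewrite le_eqVlt => /predU1P[<- t0|q1 t0].
  by rewrite powRr1// mul1r subrr subr0.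
have q0 : 0 < q by lra.
have q10 : 0 < q - 1 by lra.
have : t * 1 <= t `^ q / q + 1 `^ (q / (q - 1)) / (q / (q - 1)).
  apply: conjugate_powR => //; first by rewrite divr_gt0.
  by field; rewrite ?gt_eqF.
rewrite powR1 mulr1 -(ler_pM2l q0) => h.
rewrite lerBlDr (le_trans h)// le_eqVlt; apply/orP; left; apply/eqP.
by field; rewrite ?gt_eqF.
Qed.

(** Average the tangent line taken at the mean [a]. Total weight below 1 is harmless: the average is
    [q - (q - 1) * \sum_i w i], which is still at least 1. Bessel's inequality provides weights of
    exactly this kind. *)
Lemma powR_jensen (I : finType) q (w s : I -> R) : 1 <= q ->
  (forall i, 0 <= w i) -> (forall i, 0 <= s i) -> \sum_i w i <= 1 ->
  (\sum_i w i * s i) `^ q <= \sum_i w i * s i `^ q.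
Proof.
move=> q1 w0 s0 w1; set a := \sum_i w i * s i.
have q0 : q != 0 by rewrite gt_eqF//; lra.
have a0 : 0 <= a by apply: sumr_ge0 => i _; rewrite mulr_ge0.
move: a0; rewrite le_eqVlt => /predU1P[<-|a0].
  by rewrite powR0//; apply: sumr_ge0 => i _; rewrite mulr_ge0// powR_ge0.
have : a `^ q * \sum_i w i * (q * (s i / a) - (q - 1)) <= \sum_i w i * s i `^ q.
  rewrite mulr_sumr ler_sum// => i _; rewrite mulrCA ler_wpM2l//.
  have -> : s i `^ q = a `^ q * (s i / a) `^ q.
    by rewrite -powRM ?divr_ge0 ?(ltW a0)// [a * _]mulrC divfK ?gt_eqF.
  rewrite ler_wpM2l ?powR_ge0// powR_bernoulli// divr_ge0// ltW//.
apply: le_trans; rewrite ler_peMr ?powR_ge0//.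
rewrite (eq_bigr (fun i => (w i * s i) * (q / a) - w i * (q - 1))); last first.
  by move=> i _; ring.
rewrite sumrB -!mulr_suml -/a mulrCA mulfV ?gt_eqF// mulr1.
have := ler_wpM2r (_ : 0 <= q - 1) w1; rewrite subr_ge0 => /(_ q1); lra.
Qed.

(** [(x + y) / (a + b)] is the convex combination of [x / a] and [y / b] with weights [a / (a + b)]
    and [b / (a + b)], so Jensen applies termwise. Bounds [a] and [b] in place of norms avoid taking
    roots. *)
Lemma powR_minkowski (I : finType) q (x y : I -> R) a b : 1 <= q ->
  (forall i, 0 <= x i) -> (forall i, 0 <= y i) -> 0 < a -> 0 < b ->
  \sum_i x i `^ q <= a `^ q -> \sum_i y i `^ q <= b `^ q ->
  \sum_i (x i + y i) `^ q <= (a + b) `^ q.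
Proof.
move=> q1 x0 y0 a0 b0 xa yb; have c0 : 0 < a + b by rewrite addr_gt0.
have powD i : (x i + y i) `^ q <=
    (a + b) `^ q * (a / (a + b) * (x i `^ q / a `^ q)
                  + b / (a + b) * (y i `^ q / b `^ q)).
  pose w (k : bool) := (if k then a else b) / (a + b).
  pose s (k : bool) := if k then x i / a else y i / b.
  have := @powR_jensen bool q w s q1.
  rewrite !big_bool /w /s /= => h.
  have -> : x i + y i = (a + b) * (a / (a + b) * (x i / a) + b / (a + b) * (y i / b)).
    by field; rewrite ?gt_eqF.
  rewrite powRM ?addr_ge0 ?mulr_ge0 ?invr_ge0 ?(ltW a0) ?(ltW b0) ?(ltW c0)//.
  rewrite ler_wpM2l ?powR_ge0//.
  have E (u v : R) : 0 <= u -> 0 < v -> u `^ q / v `^ q = (u / v) `^ q.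
    move=> u0 v0; rewrite powRM// ?invr_ge0 ?ltW//.
    by rewrite -[v^-1]powR_inv1 ?ltW// -powRrM mulN1r powRN.
  rewrite !E//; apply: h.
  - by case; apply: divr_ge0; exact: ltW.
  - by case; apply: divr_ge0 => //; exact: ltW.
  - by rewrite -mulrDl divff ?gt_eqF.
apply: le_trans (ler_sum _ (fun i _ => powD i)) _.
rewrite -mulr_sumr ler_piMr ?powR_ge0// big_split /= -!mulr_sumr -!mulr_suml.
have -> : 1 = a / (a + b) * 1 + b / (a + b) * 1.
  by rewrite !mulr1 -mulrDl divff ?gt_eqF.
rewrite lerD// ler_wpM2l ?divr_ge0 ?(ltW a0) ?(ltW b0) ?(ltW c0)//.
- by rewrite ler_pdivrMr ?powR_gt0// mul1r.
- by rewrite ler_pdivrMr ?powR_gt0// mul1r.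
Qed.

End powR_inequalities.

(** * Inner products and real-valued norms *)

(** Norms over [R[i]] take complex values; this real version makes the total order and real
    arithmetic available. *)
Definition rnorm (R : realType) (V : normedZmodType R[i]) (x : V) : R := complex.Re `|x|.

Section rnorm.
Variables (R : realType).

Lemma rnormE (V : normedZmodType R[i]) (x : V) : `|x| = (rnorm x)%:C.
Proof. by rewrite /rnorm RRe_real// ger0_real. Qed.

Lemma rnorm_ge0 (V : normedZmodType R[i]) (x : V) : 0 <= rnorm x.
Proof. by rewrite -ler0c -rnormE. Qed.

Lemma rnorm0 (V : normedZmodType R[i]) : rnorm (0 : V) = 0.
Proof. by rewrite /rnorm normr0. Qed.

Lemma rnorm_eq0 (V : normedZmodType R[i]) (x : V) : rnorm x = 0 -> x = 0.
Proof. by move=> h; apply/eqP; rewrite -normr_eq0 rnormE h. Qed.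

Lemma rnormN (V : normedZmodType R[i]) (x : V) : rnorm (- x) = rnorm x.
Proof. by rewrite /rnorm normrN. Qed.

Lemma rnormB (V : normedZmodType R[i]) (x y : V) : rnorm (x - y) = rnorm (y - x).
Proof. by rewrite /rnorm distrC. Qed.

Lemma rnormD (V : normedZmodType R[i]) (x y : V) : rnorm (x + y) <= rnorm x + rnorm y.
Proof. by rewrite -lecR rmorphD /= -!rnormE ler_normD. Qed.

Lemma rnorm_sum (V : normedZmodType R[i]) (I : finType) (F : I -> V) :
  rnorm (\sum_i F i) <= \sum_i rnorm (F i).
Proof.
rewrite -lecR rmorph_sum/= -rnormE.
by rewrite (eq_bigr (fun i => `|F i|)) ?ler_norm_sum// => i _; rewrite rnormE.
Qed.

Lemma rnormM (a b : R[i]) : rnorm (a * b) = rnorm a * rnorm b.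
Proof. by apply: complexI; rewrite rmorphM /= -!rnormE normrM. Qed.

Lemma rnormZ (V : normedModType R[i]) (a : R[i]) (x : V) :
  rnorm (a *: x) = rnorm a * rnorm x.
Proof. by apply: complexI; rewrite rmorphM /= -!rnormE normrZ. Qed.

Lemma rnorm_real (a : R) : rnorm (a%:C : R[i]) = `|a|.
Proof. by rewrite /rnorm normc_def /= expr0n addr0 sqrtr_sqr. Qed.

Lemma rnorm_conj (a : R[i]) : rnorm (Num.conj a) = rnorm a.
Proof. by rewrite /rnorm norm_conjC. Qed.

Lemma rnormV (a : R[i]) : rnorm a^-1 = (rnorm a)^-1.
Proof. by apply: complexI; rewrite fmorphV /= -!rnormE normfV. Qed.

Lemma ler_Re (a : R[i]) : `|complex.Re a| <= rnorm a.
Proof.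
rewrite /rnorm normc_def /= -[leLHS]sqrtr_sqr ler_sqrt.
  by rewrite lerDl sqr_ge0.
by rewrite addr_ge0// sqr_ge0.
Qed.

Lemma rnorm_sqr (a : R[i]) : ((rnorm a) ^+ 2)%:C = a * Num.conj a.
Proof. by rewrite -normCK rnormE rmorphXn. Qed.

End rnorm.

Section inner_product.
Variables (R : realType) (H : hilbertType R).
Implicit Types (x y z : H) (a b : R[i]).

Lemma innerDl x y z : inner (x + y) z = inner x z + inner y z.
Proof. exact: (linearDl inner). Qed.
Lemma innerDr x y z : inner x (y + z) = inner x y + inner x z.
Proof. exact: (linearDr inner). Qed.
Lemma innerZl a x y : inner (a *: x) y = a * inner x y.
Proof. exact: (linearZl_LR inner). Qed.
Lemma innerZr a x y : inner x (a *: y) = Num.conj a * inner x y.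
Proof. exact: (linearZr_LR inner). Qed.
Lemma innerC x y : inner x y = Num.conj (inner y x).
Proof. by rewrite (hermC inner) expr0 mul1r. Qed.
Lemma innerNl x y : inner (- x) y = - inner x y.
Proof. exact: (linearNl inner). Qed.
Lemma innerNr x y : inner x (- y) = - inner x y.
Proof. exact: (linearNr inner). Qed.
Lemma innerBl x y z : inner (x - y) z = inner x z - inner y z.
Proof. by rewrite innerDl innerNl. Qed.
Lemma innerBr x y z : inner x (y - z) = inner x y - inner x z.
Proof. by rewrite innerDr innerNr. Qed.
Lemma inner0l x : inner 0 x = 0.
Proof. exact: (linear0l inner). Qed.
Lemma inner0r x : inner x 0 = 0.
Proof. exact: (linear0r inner). Qed.
Lemma inner_suml (I : finType) (F : I -> H) y :
  inner (\sum_i F i) y = \sum_i inner (F i) y.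
Proof. exact: (linear_sumlz inner). Qed.
Lemma inner_sumr (I : finType) (F : I -> H) x :
  inner x (\sum_i F i) = \sum_i inner x (F i).
Proof. exact: (linear_sumr inner). Qed.

Lemma innerxx x : inner x x = ((rnorm x) ^+ 2)%:C.
Proof. by rewrite inner_norm rnormE rmorphXn. Qed.

Lemma inner_ext x y : (forall z, inner z x = inner z y) -> x = y.
Proof.
move=> h; apply/eqP; rewrite -subr_eq0; apply/eqP/rnorm_eq0.
have : inner (x - y) (x - y) = 0 by rewrite innerBr h subrr.
by rewrite innerxx => -[] /eqP; rewrite sqrf_eq0 => /eqP.
Qed.

Lemma rnorm_subZ x y a : (rnorm (x - a *: y) ^+ 2)%:C =
  ((rnorm x) ^+ 2)%:C - (a * inner y x + Num.conj (a * inner y x))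
  + ((rnorm a) ^+ 2 * rnorm y ^+ 2)%:C.
Proof.
rewrite [in X in _ = _ + X]rmorphM [X in _ = _ + X * _]rnorm_sqr.
rewrite [in X in _ = X + _](rmorphM Num.conj) /=.
by rewrite -!innerxx innerBl !innerBr !innerZl !innerZr [inner x y]innerC; ring.
Qed.

Lemma cauchy_schwarz x y : rnorm (inner x y) <= rnorm x * rnorm y.
Proof.
have [->|y0] := eqVneq y 0; first by rewrite inner0r !rnorm0 mulr0.
have ny : 0 < rnorm y.
  by rewrite lt0r rnorm_ge0 andbT; apply: contra y0 => /eqP/rnorm_eq0 ->.
rewrite -(@ler_pXn2r _ 2)// ?nnegrE ?mulr_ge0 ?rnorm_ge0//.
(* With this coefficient [a *: y] is the projection of [x] on the line of [y]; the nonnegative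
   squared distance to it gives the inequality. *)
pose a := inner x y * ((rnorm y ^+ 2)^-1)%:C.
have := rnorm_subZ x y a.
have -> : a * inner y x = ((rnorm (inner x y)) ^+ 2 / rnorm y ^+ 2)%:C.
  by rewrite /a rmorphM /= rnorm_sqr [inner y x]innerC mulrAC.
have -> : Num.conj ((rnorm (inner x y) ^+ 2 / rnorm y ^+ 2)%:C)
    = (rnorm (inner x y) ^+ 2 / rnorm y ^+ 2)%:C by exact: conjc_real.
have -> : rnorm a = rnorm (inner x y) / rnorm y ^+ 2.
  by rewrite /a rnormM rnorm_real ger0_norm ?invr_ge0 ?exprn_ge0 ?rnorm_ge0.
rewrite -!(rmorphD, rmorphB) /= => -[/eqP]; set t := _ - _ + _.
have -> : t = rnorm x ^+ 2 - rnorm (inner x y) ^+ 2 / rnorm y ^+ 2.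
  by rewrite /t; field; rewrite gt_eqF.
move=> /eqP h; have : 0 <= rnorm x ^+ 2 - rnorm (inner x y) ^+ 2 / rnorm y ^+ 2.
  by rewrite -h exprn_ge0// rnorm_ge0.
by rewrite subr_ge0 ler_pdivrMr ?exprn_gt0// exprMn.
Qed.

(** Completeness in the form used for almost minimizers and almost maximizers: every set of the
    filter has points arbitrarily close to the limit. *)
Lemma complete_limit (F : set_system H) : ProperFilter F ->
  (forall e : R, 0 < e -> exists2 A, F A & forall x y, A x -> A y -> rnorm (x - y) < e) ->
  exists z, forall e : R, 0 < e -> forall A, F A -> exists2 x, A x & rnorm (z - x) < e.
Proof.
move=> FF Fc.
have : cvg F.
  apply: cauchy_cvg; apply/cauchy_ballP => e e0.
  have eE : e = (complex.Re e)%:C by rewrite RRe_real// gtr0_real.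
  have re0 : 0 < complex.Re e by rewrite -ltcR -eE.
  have [A FA Ah] := Fc _ re0.
  exists (A, A) => // -[x y] [/= Ax Ay].
  by rewrite -ball_normE /= eE rnormE ltcR Ah.
move=> /fcvgrPdist_lt cF; exists (lim F) => e e0 A FA.
have ec0 : 0 < e%:C by rewrite ltcR.
have [x [Ax]] := filter_ex (filterI FA (cF _ ec0)).
by rewrite /= rnormE ltcR => ?; exists x.
Qed.

End inner_product.

(** * The Riesz representation theorem *)

Section riesz.
Variables (R : realType) (H : hilbertType R).
Implicit Types (x y z : H) (a b : R[i]).

Lemma rnorm_sqrD x y :
  rnorm (x + y) ^+ 2 = rnorm x ^+ 2 + rnorm y ^+ 2 + 2 * complex.Re (inner x y).
Proof.
have -> : rnorm (x + y) ^+ 2 = complex.Re (inner (x + y) (x + y)) by rewrite innerxx.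
rewrite innerDl !innerDr !innerxx [inner y x]innerC.
by case: (inner x y) => u v /=; ring.
Qed.

Lemma parallelogram x y : rnorm (x + y) ^+ 2 + rnorm (x - y) ^+ 2 =
  2 * (rnorm x ^+ 2 + rnorm y ^+ 2).
Proof.
by rewrite !rnorm_sqrD rnormN innerNr raddfN; ring.
Qed.

(* The representing vector is the minimizer of [J x = |x|^2 - 2 Re (f x)]: by
   the parallelogram law almost minimizers are close to each other, and at an
   almost minimizer the first variation of [J] is almost zero. *)
Lemma riesz (f : H -> R[i]) M : (forall x y, f (x + y) = f x + f y) ->
  (forall a x, f (a *: x) = a * f x) ->
  (forall x, rnorm (f x) <= M * rnorm x) -> exists z, forall x, f x = inner x z.
Proof.
move=> fD fZ fM.
pose J x := rnorm x ^+ 2 - 2 * complex.Re (f x).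
have JM x : - M ^+ 2 <= J x.
  have := sqr_ge0 (rnorm x - M); have := le_trans (ler_Re (f x)) (fM x).
  by rewrite ler_norml /J => /andP[_]; nra.
pose E := range J.
have Einf : has_inf E.
  by split; [exists (J 0), 0 | exists (- M ^+ 2) => _ [x _ <-]].
have Jd x : inf E <= J x by apply: ge_inf; [case: Einf|exists x].
have ReZ (t : R) a : complex.Re (t%:C * a) = t * complex.Re a.
  by case: a => u v /=; rewrite mul0r subr0.
pose S (d : R) := [set x | J x < inf E + d].
have SF : ProperFilter (filter_from [set d : R | 0 < d] S).
  apply: filter_from_proper.
    apply: filter_from_filter; first by exists 1 => /=.
    move=> d e /= d0 e0; exists (Num.min d e); first by rewrite lt_min d0 e0.
    move=> x; rewrite /S /= => h; split; apply: lt_le_trans h _;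
      by rewrite lerD2l ge_min lexx ?orbT.
  by move=> d /= d0; have [_ [x _ <-] ?] := inf_adherent d0 Einf; exists x.
have [|z hz] := complete_limit SF.
  (* By the parallelogram law, [|x - y|^2 = 2 J x + 2 J y - 4 J ((x + y) / 2)], which is below [4 d]
     on [S d]; here that is [e ^+ 2 / 2]. *)
  move=> e e0; exists (S (e ^+ 2 / 8)).
    by exists (e ^+ 2 / 8) => //=; rewrite divr_gt0// exprn_gt0.
  move=> x y; rewrite /S /= => Sx Sy.
  have := Jd (2^-1%:C *: (x + y)).
  rewrite /J rnormZ rnorm_real fZ ReZ fD raddfD /= ger0_norm ?invr_ge0// exprMn => Jxy.
  rewrite -(@ltr_pXn2r _ 2)// ?nnegrE ?rnorm_ge0 ?ltW//.
  have := parallelogram x y; have := exprn_gt0 2 e0; rewrite /J in Sx Sy; lra.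
have Re_eq h : complex.Re (f h) = complex.Re (inner h z).
  pose c := complex.Re (f h) - complex.Re (inner h z).
  suff c0 e : 0 < e -> `|c| <= e * (1 + 2 * rnorm h).
    have h0 : 0 < 1 + 2 * rnorm h by have := rnorm_ge0 h; lra.
    apply/eqP; rewrite -subr_eq0 -/c -normr_le0; apply/ler_addgt0Pr => e e0.
    by rewrite add0r (le_trans (c0 _ (divr_gt0 e0 h0)))// divfK// gt_eqF.
  move=> e0; have [|x Sx xz] := hz e e0 (S (e ^+ 2)).
    by exists (e ^+ 2) => //=; rewrite exprn_gt0.
  have r0 := rnorm_ge0 h.
  (* Along the line through [x] in direction [h], [J (x + t h) = J x - 2 t b + t^2 |h|^2]. The best
     [t] is [b / |h|^2], with gain [b^2 / |h|^2], and the gain cannot exceed the gap [e ^+ 2] to the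
     infimum. *)
  pose b := complex.Re (f h) - complex.Re (inner x h).
  have bh : b ^+ 2 <= (e * rnorm h) ^+ 2.
    have [h0|h0] := eqVneq (rnorm h) 0.
      move: h0 => /rnorm_eq0 h0; rewrite /b h0 inner0r rnorm0.
      by rewrite -[0 : H](scale0r 0) fZ mul0r /= subrr mulr0.
    have hp : 0 < rnorm h by rewrite lt0r h0 r0.
    have := Jd (x + (b / rnorm h ^+ 2)%:C *: h).
    rewrite /J rnorm_sqrD rnormZ innerZr fD fZ [Num.conj _]conjc_real raddfD /= !ReZ.
    rewrite rnorm_real exprMn [ `|_| ^+ 2]real_normK ?num_real//.
    rewrite /S /= /J in Sx.
    set u := complex.Re _ => h1.
    have : inf E <= J x - b ^+ 2 / rnorm h ^+ 2.
      apply: le_trans h1 _; rewrite /J /b -/u le_eqVlt; apply/orP; left.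
      by apply/eqP; field.
    rewrite lerBrDr => h2; rewrite exprMn -ler_pdivrMr ?exprn_gt0//.
    by rewrite -/(J x) in Sx; lra.
  have be : `|b| <= e * rnorm h.
    by rewrite -(@ler_pXn2r _ 2)// ?nnegrE ?mulr_ge0 ?(ltW e0)// real_normK ?num_real.
  have -> : c = b + complex.Re (inner h (x - z)).
    rewrite /c /b innerBr raddfB /= [inner h x]innerC.
    by case: (inner x h) => u v /=; ring.
  have := le_trans (ler_Re _) (cauchy_schwarz h (x - z)); rewrite [rnorm (x - z)]rnormB.
  have := ler_normD b (complex.Re (inner h (x - z))); nra.
exists z => x; have := Re_eq x; have := Re_eq ('i%C *: x).
rewrite fZ innerZl; case: (f x) (inner x z) => u v [u' v'] /=.
by rewrite !mul0r !mul1r !sub0r => /oppr_inj -> ->.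
Qed.

End riesz.

(** * Compact operators and their adjoints *)

Section operators.
Variables (R : realType) (H : hilbertType R).
Implicit Types (x y z : H) (a b : R[i]) (S T : H -> H).

(** Recording [T'] explicitly certifies that an adjoint exists, so that the default value in
    [adjoint] never interferes. *)
Definition adjoint_pair T T' := forall x y, inner (T x) y = inner x (T' y).

Definition bounded_op T := exists2 M : R, 0 < M & forall x, rnorm (T x) <= M * rnorm x.

Definition tot_bounded_op T := forall e : R, 0 < e -> exists l : seq H,
  forall x, rnorm x <= 1 -> exists2 c, c \in l & rnorm (T x - c) < e.

Definition compact_pair T T' := adjoint_pair T T' /\ tot_bounded_op T.

Lemma adjoint_pairC T T' : adjoint_pair T T' -> adjoint_pair T' T.
Proof. by move=> h x y; rewrite innerC -h -innerC. Qed.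

Lemma adjoint_pairE T T' : adjoint_pair T T' -> adjoint T = T'.
Proof.
move=> h; apply/funext => y; rewrite /adjoint; case: xgetP => [z -> hz|/(_ (T' y)) []//].
by apply: inner_ext => x; rewrite -h hz.
Qed.

Lemma adjoint_pairD T T' S S' : adjoint_pair T T' -> adjoint_pair S S' ->
  adjoint_pair (T \+ S) (T' \+ S').
Proof. by move=> h k x y /=; rewrite innerDl h k innerDr. Qed.

Lemma adjoint_pairZ T T' a : adjoint_pair T T' ->
  adjoint_pair (a \*: T) (Num.conj a \*: T').
Proof. by move=> h x y /=; rewrite innerZl h innerZr conjCK. Qed.

Lemma adjoint_pair_comp T T' S S' : adjoint_pair T T' -> adjoint_pair S S' ->
  adjoint_pair (T \o S) (S' \o T').
Proof. by move=> h k x y /=; rewrite h k. Qed.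

Section linearity.
Variables T T' : H -> H.
Hypothesis TT' : adjoint_pair T T'.

(** Having an adjoint forces linearity: test against every [z] and move [T] to the other side. *)
Lemma adjoint_linD x y : T (x + y) = T x + T y.
Proof. by apply: inner_ext => z; rewrite innerDr -!(adjoint_pairC TT') innerDr. Qed.

Lemma adjoint_linZ a x : T (a *: x) = a *: T x.
Proof. by apply: inner_ext => z; rewrite innerZr -!(adjoint_pairC TT') innerZr. Qed.

Lemma adjoint_linB x y : T (x - y) = T x - T y.
Proof. by rewrite -[in LHS]scaleN1r adjoint_linD adjoint_linZ scaleN1r. Qed.

Lemma adjoint_lin0 : T 0 = 0.
Proof. by rewrite -(scale0r 0) adjoint_linZ !scale0r. Qed.

Lemma adjoint_lin_sum (I : finType) (F : I -> H) : T (\sum_i F i) = \sum_i T (F i).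
Proof. by apply: big_morph; [exact: adjoint_linD|exact: adjoint_lin0]. Qed.

Lemma bounded_op_adj : bounded_op T -> bounded_op T'.
Proof.
move=> [M M0 TM]; exists M => // y.
have [|n0] := eqVneq (rnorm (T' y)) 0.
  by move=> ->; rewrite mulr_ge0 ?rnorm_ge0 ?ltW.
have n1 : 0 < rnorm (T' y) by rewrite lt0r n0 rnorm_ge0.
rewrite -(ler_pM2l n1) -expr2.
have -> : rnorm (T' y) ^+ 2 = rnorm (inner (T (T' y)) y).
  by rewrite TT' innerxx rnorm_real ger0_norm// exprn_ge0// rnorm_ge0.
rewrite (le_trans (cauchy_schwarz _ _))// mulrA ler_wpM2r ?rnorm_ge0//.
by rewrite mulrC.
Qed.

End linearity.

Lemma tot_bounded_bounded T : (forall a x, T (a *: x) = a *: T x) ->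
  tot_bounded_op T -> bounded_op T.
Proof.
move=> TZ /(_ 1 ltr01)[l lT].
exists (1 + \sum_(c <- l) rnorm c).
  by rewrite ltr_pwDl// sumr_ge0// => c _; rewrite rnorm_ge0.
have bd x : rnorm x <= 1 -> rnorm (T x) <= 1 + \sum_(c <- l) rnorm c.
  move=> /lT[c cl xc]; rewrite -[T x](subrK c) (le_trans (rnormD _ _))//.
  rewrite lerD ?(ltW xc)// (big_rem c)//= lerDl sumr_ge0// => d _.
  exact: rnorm_ge0.
move=> x; have [x0|x0] := eqVneq (rnorm x) 0.
  by rewrite x0 mulr0 (rnorm_eq0 x0) -(scale0r (0 : H)) TZ scale0r rnorm0.
have xp : 0 < rnorm x by rewrite lt0r x0 rnorm_ge0.
have := bd ((rnorm x)^-1%:C *: x); rewrite TZ !rnormZ rnorm_real.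
rewrite ger0_norm ?invr_ge0 ?rnorm_ge0// mulVf// => /(_ (lexx _)).
by rewrite mulrC ler_pdivrMr.
Qed.

Lemma compact_pair_bounded T T' : compact_pair T T' -> bounded_op T.
Proof. by move=> [h]; apply: tot_bounded_bounded; exact: adjoint_linZ h. Qed.

Lemma compact_pairD T T' S S' : compact_pair T T' -> compact_pair S S' ->
  compact_pair (T \+ S) (T' \+ S').
Proof.
move=> [h tT] [k tS]; split; first exact: adjoint_pairD.
move=> e e0; have e2 : 0 < e / 2 by rewrite divr_gt0.
have [[l hl] [m hm]] := (tT _ e2, tS _ e2).
exists [seq c + d | c <- l, d <- m] => x x1.
have [[c cl xc] [d dm xd]] := (hl x x1, hm x x1).
exists (c + d); first by apply/allpairsP; exists (c, d).
rewrite /= opprD addrACA (le_lt_trans (rnormD _ _))// [ltRHS]splitr ltrD//.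
Qed.

Lemma compact_pair_compl T T' S S' : compact_pair T T' -> adjoint_pair S S' ->
  bounded_op S -> compact_pair (S \o T) (T' \o S').
Proof.
move=> [h tT] k [M M0 SM]; split; first exact: adjoint_pair_comp.
move=> e e0; have [l hl] := tT _ (divr_gt0 e0 M0).
exists (map S l) => x x1; have [c cl xc] := hl x x1.
exists (S c); first exact: map_f.
rewrite /= -(adjoint_linB k) (le_lt_trans (SM _))// mulrC -ltr_pdivlMr//.
Qed.

(** [S] sends the unit ball into the ball of radius [M], so a net of mesh [e / M] for [T] is scaled
    up by [M]. *)
Lemma compact_pair_compr T T' S S' : compact_pair T T' -> adjoint_pair S S' ->
  bounded_op S -> compact_pair (T \o S) (S' \o T').
Proof.
move=> [h tT] k [M M0 SM]; split; first exact: adjoint_pair_comp.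
move=> e e0; have [l hl] := tT _ (divr_gt0 e0 M0).
exists (map (GRing.scale M%:C) l) => x x1.
have [|c cl xc] := hl (M^-1%:C *: S x).
  rewrite rnormZ rnorm_real ger0_norm ?invr_ge0 ?(ltW M0)// mulrC ler_pdivrMr// mul1r.
  by rewrite (le_trans (SM _))// ler_piMr// ltW.
exists (M%:C *: c); first exact: map_f.
have -> : (T \o S) x = M%:C *: T (M^-1%:C *: S x).
  by rewrite -(adjoint_linZ h) scalerA -rmorphM /= mulfV ?gt_eqF// scale1r.
by rewrite -scalerBr rnormZ rnorm_real gtr0_norm// mulrC -ltr_pdivlMr.
Qed.

Lemma compact_pairZ T T' a : compact_pair T T' ->
  compact_pair (a \*: T) (Num.conj a \*: T').
Proof.
move=> [h tT].
have k : adjoint_pair (a \*: @id H) (Num.conj a \*: @id H) by exact: adjoint_pairZ.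
have [|_ tZ] := compact_pair_compl (conj h tT) k.
  exists (rnorm a + 1); first by rewrite ltr_wpDl// rnorm_ge0.
  by move=> x; rewrite rnormZ ler_wpM2r ?rnorm_ge0// lerDl.
by split; first exact: adjoint_pairZ.
Qed.

(* Schauder: [|T' x - T' y|^2 = <T T' (x - y), x - y>], and [T T'] is compact. *)
Lemma compact_pairC T T' : compact_pair T T' -> compact_pair T' T.
Proof.
move=> cT; have [h tT] := cT; have h' := adjoint_pairC h.
split=> // e e0.
have [_ tTT'] := compact_pair_compr cT h' (bounded_op_adj h (compact_pair_bounded cT)).
have e4 : 0 < e ^+ 2 / 4 by rewrite divr_gt0// exprn_gt0.
have [l hl] := tTT' _ e4.
(* Net points for [T \o T'] must be traded for vectors [T' y] with [y] in the unit ball. If [x] and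
   [y] share a net point, then [|T T' (x - y)| < e^2 / 2] and [|x - y| <= 2], so the product is
   below [e^2]. Net points near no image get the irrelevant default 0. *)
pose near_pt c y := rnorm y <= 1 /\ rnorm (T (T' y) - c) < e ^+ 2 / 4.
exists [seq T' (xget 0 (near_pt c)) | c <- l] => x x1.
have [c cl xc] := hl x x1; exists (T' (xget 0 (near_pt c))); first exact: map_f.
have [y1 yc] : near_pt c (xget 0 (near_pt c)) by apply: (@xgetPex _ 0); exists x.
move: y1 yc; set y := xget _ _ => y1 yc.
rewrite -(@ltr_pXn2r _ 2)// ?nnegrE ?rnorm_ge0 ?(ltW e0)//.
have -> : rnorm (T' x - T' y) ^+ 2 = rnorm (inner (T (T' (x - y))) (x - y)).
  by rewrite h (adjoint_linB h') innerxx rnorm_real ger0_norm// exprn_ge0// rnorm_ge0.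
have n2 : rnorm (x - y) <= 2.
  by rewrite (le_trans (rnormD _ _))// rnormN; lra.
have n1 : rnorm (T (T' (x - y))) < e ^+ 2 / 2.
  rewrite (adjoint_linB h') (adjoint_linB h) -(subrKA c).
  rewrite (le_lt_trans (rnormD _ _))// [X in _ + X]rnormB.
  by move: xc yc => /=; lra.
apply: le_lt_trans (cauchy_schwarz _ _) _.
have := rnorm_ge0 (T (T' (x - y))); nra.
Qed.

(** Refine [F] to an ultrafilter. For each mesh one ball of the finite net must have its preimage in
    it, as otherwise all the complements would be there, with empty intersection in the unit ball.
    The image ultrafilter is thus Cauchy. *)
Lemma tot_bounded_cluster T (F : set_system H) : ProperFilter F ->
  F [set x | rnorm x <= 1] -> tot_bounded_op T ->
  exists y, forall e : R, 0 < e -> forall A, F A -> exists2 x, A x & rnorm (y - T x) < e.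
Proof.
move=> FF F1 tT; have [G [GU FG]] := ultraFilterLemma FF.
have [|y hy] := @complete_limit _ _ (T @ G) _.
  move=> e e0; have [l hl] := tT _ (divr_gt0 e0 (ltr0Sn _ 1)).
  suff [c hc] : exists c, G [set x | rnorm (T x - c) < e / 2].
    exists [set x | rnorm (x - c) < e / 2] => // x y /= xc yc.
    by rewrite -(subrKA c) (le_lt_trans (rnormD _ _))// [rnorm (c - y)]rnormB; lra.
  apply: contrapT => nG.
  have {}nG c : G (~` [set x | rnorm (T x - c) < e / 2]).
    case: (in_ultra_setVsetC [set x | rnorm (T x - c) < e / 2] GU) => // h.
    by case: nG; exists c.
  have : G [set x | forall c, c \in l -> ~ rnorm (T x - c) < e / 2].
    elim: l {hl} => [|c l ih]; first exact: filterS filterT.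
    apply: filterS (filterI (nG c) ih) => x [/= xc xl] d.
    by rewrite inE => /predU1P[->|/xl].
  move=> /(filterI (FG _ F1))/filter_ex[x [/= /hl[c cl xc] /(_ c cl)]]; exact.
exists y => e e0 A /FG GA.
have [|_ [x Ax <-] ?] := hy e e0 (T @` A); last by exists x.
by rewrite nbhs_simpl /=; apply: filterS GA => x Ax /=; exists x.
Qed.

Lemma compact_operator_tot_bounded T : compact_operator T -> tot_bounded_op T.
Proof.
rewrite /compact_operator precompactE compact_cover => cT e e0.
have e2 : 0 < e%:C by rewrite ltcR.
have [||D _ TD] := cT H [set: H] (fun c => ball c e%:C).
- by move=> c _; exact: ball_open.
- by move=> x _; exists x => //; exact: ballxx.
exists (enum_fset D) => x x1.
have [c cD] : cover [set` D] (fun c => ball c e%:C) (T x).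
  apply/TD/subset_closure; exists x => //=.
  by rewrite rnormE lecR.
rewrite -ball_normE /= rnormE ltcR rnormB => ?; by exists c.
Qed.

(** Compactness gives boundedness, and Riesz then provides the vector that [adjoint] selects. *)
Lemma compact_adjoint T : linear T -> compact_operator T -> compact_pair T (adjoint T).
Proof.
move=> lT /compact_operator_tot_bounded tT.
have TD x y : T (x + y) = T x + T y by have := lT 1 x y; rewrite !scale1r.
have T0 : T 0 = 0.
  by have := lT (-1) 0 0; rewrite !scaleN1r oppr0 addr0 => ->; rewrite addNr.
have TZ a x : T (a *: x) = a *: T x by rewrite -[a *: x]addr0 lT T0 addr0.
have [M M0 TM] := tot_bounded_bounded TZ tT.
split=> // x y; rewrite /adjoint; case: xgetP => [z _ /(_ x)//|noz].
have [|||z hz] := @riesz R H (fun u => inner (T u) y) (M * rnorm y).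
- by move=> u v; rewrite TD innerDl.
- by move=> a u; rewrite TZ innerZl.
- move=> u; rewrite (le_trans (cauchy_schwarz _ _))// mulrAC ler_wpM2r ?rnorm_ge0//.
- by case: (noz z).
Qed.

End operators.

(** * Singular vectors of compact operators *)

Section spectral.
Variables (R : realType) (H : hilbertType R).
Implicit Types (x y z : H) (a b : R[i]) (S T : H -> H).

Definition orthonormal_fam (I : finType) (e : I -> H) :=
  forall i j, inner (e i) (e j) = (i == j)%:R.

Definition proj_compl (I : finType) (e : I -> H) x := x - \sum_i inner x (e i) *: e i.

Section orthonormal_families.
Variables (I : finType) (e : I -> H).
Hypothesis oe : orthonormal_fam e.

Lemma orthonormal_rnorm i : rnorm (e i) = 1.
Proof.
have := oe i i; rewrite eqxx innerxx => -[/eqP].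
by rewrite sqrp_eq1 ?rnorm_ge0// => /eqP.
Qed.

Lemma inner_sum_orthonormal (c : I -> R[i]) j : inner (\sum_i c i *: e i) (e j) = c j.
Proof.
rewrite inner_suml (bigD1 j)//= innerZl oe eqxx mulr1 big1 ?addr0// => i ij.
by rewrite innerZl oe (negbTE ij) mulr0.
Qed.

Lemma proj_compl_ortho x j : inner (proj_compl e x) (e j) = 0.
Proof. by rewrite innerBl inner_sum_orthonormal subrr. Qed.

Lemma proj_compl_rnorm x :
  rnorm (proj_compl e x) ^+ 2 = rnorm x ^+ 2 - \sum_i rnorm (inner x (e i)) ^+ 2.
Proof.
apply: complexI; rewrite rmorphB rmorph_sum /= -!innerxx.
rewrite [X in inner _ X]/proj_compl innerBr.
rewrite inner_sumr big1 ?subr0 => [|i _].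
  rewrite /proj_compl innerBl; congr (_ - _); rewrite inner_suml; apply: eq_bigr => i _.
  by rewrite innerZl -/(real_complex R _) rnorm_sqr -innerC.
by rewrite innerZr proj_compl_ortho mulr0.
Qed.

Lemma bessel x : \sum_i rnorm (inner x (e i)) ^+ 2 <= rnorm x ^+ 2.
Proof. by rewrite -subr_ge0 -proj_compl_rnorm exprn_ge0// rnorm_ge0. Qed.

Lemma proj_compl_le x : rnorm (proj_compl e x) <= rnorm x.
Proof.
rewrite -(@ler_pXn2r _ 2)// ?nnegrE ?rnorm_ge0// proj_compl_rnorm gerBl.
by apply: sumr_ge0 => i _; rewrite exprn_ge0// rnorm_ge0.
Qed.

End orthonormal_families.

Lemma le0_small (r C : R) : 0 <= C -> (forall d, 0 < d -> r <= C * d) -> r <= 0.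
Proof.
move=> C0 h; have C1 : 0 < C + 1 by lra.
apply/ler_addgt0Pr => d d0; rewrite add0r (le_trans (h _ (divr_gt0 d0 C1)))//.
by rewrite mulrA ler_pdivrMr// mulrC ler_wpM2l ?(ltW d0)//; lra.
Qed.

Section top_eigenvector.
Variables (T T' : H -> H) (I : finType) (e : I -> H).
Hypothesis cT : compact_pair T T'.
Hypothesis eig : forall i, exists c : R[i], T' (T (e i)) = c *: e i.
Let M := [set x | forall i, inner x (e i) = 0].

Let TT' : adjoint_pair T T'. Proof. by case: cT. Qed.
Let T'T : adjoint_pair T' T. Proof. exact: adjoint_pairC. Qed.

Let M_invariant x : M x -> M (T' (T x)).
Proof.
move=> Mx i; have [c ec] := eig i.
by rewrite T'T TT' ec innerZr Mx mulr0.
Qed.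

Let MZ a x : M x -> M (a *: x).
Proof. by move=> Mx i; rewrite innerZl Mx mulr0. Qed.

Let W := [set rnorm (T x) | x in [set x | M x /\ rnorm x <= 1]].
Let m := sup W.

Let W_sup : has_sup W.
Proof.
have [K K0 TK] := compact_pair_bounded cT.
split; first by exists (rnorm (T 0)), 0 => //; split=> [i|]; rewrite ?inner0l ?rnorm0.
exists K => _ [x [_ x1] <-]; rewrite (le_trans (TK x))// ler_piMr// ltW//.
Qed.

Let le_m x : M x -> rnorm (T x) <= m * rnorm x.
Proof.
move=> Mx; have [x0|x0] := eqVneq (rnorm x) 0.
  by rewrite x0 mulr0 (rnorm_eq0 x0) (adjoint_lin0 TT') rnorm0.
have xp : 0 < rnorm x by rewrite lt0r x0 rnorm_ge0.
have : W (rnorm (T ((rnorm x)^-1%:C *: x))).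
  exists ((rnorm x)^-1%:C *: x) => //; split; first exact: MZ.
  by rewrite rnormZ rnorm_real ger0_norm ?invr_ge0 ?rnorm_ge0// mulVf.
move=> /(sup_upper_bound W_sup); rewrite (adjoint_linZ TT') rnormZ rnorm_real.
by rewrite ger0_norm ?invr_ge0 ?rnorm_ge0// mulrC ler_pdivrMr.
Qed.

(* [|T'Tx - m^2 x|^2 <= m^2 (m^2 - |Tx|^2)] for [x] in the unit ball of [M], so
   vectors that almost attain the norm [m] of [T] on [M] are almost eigenvectors. *)
Let almost_eigenvector x : M x -> rnorm x <= 1 ->
  rnorm (T' (T x) - (m ^+ 2)%:C *: x) ^+ 2 <= m ^+ 2 * (m ^+ 2 - rnorm (T x) ^+ 2).
Proof.
move=> Mx x1; have := rnorm_subZ (T' (T x)) x (m ^+ 2)%:C.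
rewrite -TT' innerxx -rmorphM /= [Num.conj _]conjc_real -!(rmorphD, rmorphB) /= => -[->].
rewrite rnorm_real ger0_norm ?sqr_ge0//.
have m0 : 0 <= m.
  by apply: le_trans (rnorm_ge0 (T x)) _; apply: sup_upper_bound W_sup _ _; exists x.
have T'Tx : rnorm (T' (T x)) ^+ 2 <= m ^+ 2 * rnorm (T x) ^+ 2.
  rewrite -exprMn ler_pXn2r// ?nnegrE ?mulr_ge0 ?rnorm_ge0//.
  have [->|n0] := eqVneq (rnorm (T' (T x))) 0; first by rewrite mulr_ge0 ?rnorm_ge0.
  have n1 : 0 < rnorm (T' (T x)) by rewrite lt0r n0 rnorm_ge0.
  rewrite -(ler_pM2l n1) -expr2.
  have -> : rnorm (T' (T x)) ^+ 2 = rnorm (inner (T (T' (T x))) (T x)).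
    by rewrite TT' innerxx rnorm_real ger0_norm// exprn_ge0// rnorm_ge0.
  rewrite (le_trans (cauchy_schwarz _ _))// mulrA ler_wpM2r ?rnorm_ge0//.
  by rewrite mulrC le_m//; exact: M_invariant.
have x2 : rnorm x ^+ 2 <= 1 by rewrite expr_le1// rnorm_ge0.
have := exprn_ge0 2 (sqr_ge0 m); nra.
Qed.

(** The orthogonal complement [M] of eigenvectors is invariant under [T' \o T], and [x0] shows that
    the norm [m] of [T] on [M] exceeds [r]. Almost maximizers [x] are almost eigenvectors, so [x] is
    close to [m^-2 T' (T x)]; a cluster point [y] of the [T x] then makes them approach
    [z = m^-2 T' y], which inherits the exact eigenvalue equation. *)
Lemma top_eigenvector r x0 : 0 < r ->
  (forall i, inner x0 (e i) = 0) -> r * rnorm x0 < rnorm (T x0) ->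
  exists u s, [/\ r <= s, rnorm u = 1, forall i, inner u (e i) = 0 &
    T' (T u) = (s ^+ 2)%:C *: u].
Proof.
move=> r0 Mx0 rx0.
have rm : r < m.
  rewrite ltNge; apply/negP => mr; have := le_m Mx0; rewrite leNgt => /negP; apply.
  by rewrite (le_lt_trans _ rx0)// ler_wpM2r ?rnorm_ge0.
have m0 : 0 < m := lt_trans r0 rm.
have [K K0 TK] := compact_pair_bounded cT.
have [K' K'0 TK'] := compact_pair_bounded (compact_pairC cT).
pose S (d : R) := [set x | [/\ M x, rnorm x <= 1 & m - d < rnorm (T x)]].
have SF : ProperFilter (filter_from [set d : R | 0 < d] S).
  apply: filter_from_proper.
    apply: filter_from_filter; first by exists 1 => /=.
    move=> d d' /= d0 d'0; exists (Num.min d d'); first by rewrite lt_min d0 d'0.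
    by move=> x [Mx x1 h]; split; split=> //; apply: le_lt_trans h;
      rewrite lerB// ge_min lexx ?orbT.
  move=> d /= d0; have [_ [x [Mx x1] <-] ?] := sup_adherent d0 W_sup.
  by exists x.
have [|y hy] := tot_bounded_cluster SF _ (proj2 cT).
  by exists 1 => //= x [].
pose z := (m ^- 2)%:C *: T' y.
pose C := (K' + 1) / m ^+ 2.
have C0 : 0 <= C by rewrite divr_ge0 ?sqr_ge0//; lra.
(* The margin [d'] is chosen so that [m^2 (m^2 - |T x|^2) <= 2 m^3 d' <= d^2]. The constant [C] adds
   the errors [K' d] from [T' (y - T x)] and [d] from the eigenvalue equation, both divided by
   [m^2]. *)
have close d : 0 < d -> exists x, [/\ M x,
    rnorm (T' (T x) - (m ^+ 2)%:C *: x) <= d, m - d < rnorm (T x) &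
    rnorm (z - x) <= C * d].
  move=> d0; pose d' := Num.min d (d ^+ 2 / (2 * m ^+ 3)).
  have d'0 : 0 < d' by rewrite lt_min d0 divr_gt0 ?mulr_gt0 ?exprn_gt0.
  have [|x [Mx x1 Txm] xy] := hy d d0 (S d'); first by exists d'.
  have Txm' : m - d < rnorm (T x) by rewrite (le_lt_trans _ Txm)// lerB// ge_min lexx.
  have Tm : rnorm (T x) <= m by rewrite (le_trans (le_m Mx))// ler_piMr// ltW.
  have ev : rnorm (T' (T x) - (m ^+ 2)%:C *: x) <= d.
    rewrite -(@ler_pXn2r _ 2)// ?nnegrE ?rnorm_ge0 ?(ltW d0)//.
    rewrite (le_trans (almost_eigenvector Mx x1))//.
    have h : d' * (2 * m ^+ 3) <= d ^+ 2.
      by rewrite -ler_pdivlMr ?mulr_gt0 ?exprn_gt0// ge_min lexx orbT.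
    apply: le_trans h; rewrite (_ : d' * _ = m ^+ 2 * (2 * m * d')); last by ring.
    rewrite ler_wpM2l ?sqr_ge0//; have := rnorm_ge0 (T x); nra.
  exists x; split=> //.
  have -> : z - x = (m ^- 2)%:C *: (T' (y - T x) + (T' (T x) - (m ^+ 2)%:C *: x)).
    rewrite (adjoint_linB T'T) addrA subrK scalerBr scalerA -rmorphM /= mulVf ?scale1r//.
    by rewrite expf_neq0// gt_eqF.
  rewrite rnormZ rnorm_real ger0_norm ?invr_ge0 ?sqr_ge0// /C mulrC mulrAC.
  rewrite ler_wpM2r ?invr_ge0 ?sqr_ge0// (le_trans (rnormD _ _))// mulrDl mul1r lerD//.
  by rewrite (le_trans (TK' _))// ler_wpM2l ?(ltW K'0)// ltW.
have Mz i : inner z (e i) = 0.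
  apply: rnorm_eq0; apply/eqP; rewrite eq_le rnorm_ge0 andbT.
  apply: (@le0_small _ (C * rnorm (e i))); first by rewrite mulr_ge0// rnorm_ge0.
  move=> d /close[x [Mx _ _ zx]]; rewrite -(subrK x z) innerDl Mx addr0.
  by rewrite (le_trans (cauchy_schwarz _ _))// mulrAC ler_wpM2r ?rnorm_ge0.
have mz : m <= rnorm (T z).
  rewrite -subr_le0; apply: (@le0_small _ (1 + K * C)).
    by rewrite addr_ge0// mulr_ge0// ltW.
  move=> d /close[x [_ _ Txm zx]].
  have h : rnorm (T x) <= rnorm (T z) + K * (C * d).
    rewrite -(subrK (T z) (T x)) (le_trans (rnormD _ _))// addrC lerD//.
    rewrite -(adjoint_linB TT').
    by rewrite (le_trans (TK _))// ler_wpM2l ?(ltW K0)// rnormB.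
  by lra.
have eigz : T' (T z) = (m ^+ 2)%:C *: z.
  apply/eqP; rewrite -subr_eq0; apply/eqP/rnorm_eq0/eqP; rewrite eq_le rnorm_ge0 andbT.
  apply: (@le0_small _ (K' * (K * C) + (1 + m ^+ 2 * C))).
    have := mulr_ge0 (ltW K'0) (mulr_ge0 (ltW K0) C0).
    by have := mulr_ge0 (sqr_ge0 m) C0; lra.
  move=> d /close[x [_ ev _ zx]].
  have -> : T' (T z) - (m ^+ 2)%:C *: z = T' (T (z - x)) +
      ((T' (T x) - (m ^+ 2)%:C *: x) + (m ^+ 2)%:C *: (x - z)).
    rewrite (adjoint_linB TT') (adjoint_linB T'T) scalerBr.
    by rewrite !addrA !subrK.
  rewrite (le_trans (rnormD _ _))// mulrDl lerD//.
    rewrite (le_trans (TK' _))// -mulrA ler_wpM2l ?(ltW K'0)//.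
    by rewrite (le_trans (TK _))// -mulrA ler_wpM2l ?(ltW K0).
  rewrite (le_trans (rnormD _ _))// mulrDl mul1r lerD// rnormZ rnorm_real.
  by rewrite ger0_norm ?sqr_ge0// rnormB -[leRHS]mulrA ler_wpM2l ?sqr_ge0.
have z0 : rnorm z != 0.
  by apply: contraTneq mz => /rnorm_eq0 ->; rewrite (adjoint_lin0 TT') rnorm0 -ltNge.
exists ((rnorm z)^-1%:C *: z), m; split.
- exact: ltW.
- by rewrite rnormZ rnorm_real ger0_norm ?invr_ge0 ?rnorm_ge0// mulVf.
- by move=> i; rewrite innerZl Mz mulr0.
- by rewrite (adjoint_linZ TT') (adjoint_linZ T'T) eigz !(scalerA _ _ z) mulrC.
Qed.

End top_eigenvector.

Definition singular_fam T T' (I : finType) (e : I -> H) (s : I -> R) :=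
  orthonormal_fam e /\ forall i, T' (T (e i)) = (s i ^+ 2)%:C *: e i.

(** Pigeonhole: the vectors [T (e i)] are pairwise orthogonal of norm at least [r], so no two of
    them lie in a common ball of radius [r / 2] of the net. *)
Lemma singular_fam_bound T T' (r : R) : compact_pair T T' -> 0 < r ->
  exists n, forall (I : finType) (e : I -> H) s, singular_fam T T' e s ->
    (forall i, r <= s i) -> (#|I| <= n)%N.
Proof.
move=> [TT' tT] r0; have [l hl] := tT _ (divr_gt0 r0 (ltr0Sn _ 1)).
exists (size l) => I e s [oe es] rs; rewrite leqNgt; apply/negP => ltl.
have /choice[f fP] : forall i, exists c, c \in l /\ rnorm (T (e i) - c) < r / 2.
  by move=> i; have [|c ? ?] := hl (e i); [rewrite (orthonormal_rnorm oe)|exists c].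
have [i [j [ij fij]]] : exists i j, i != j /\ f i = f j.
  apply: contrapT => ninj; suff : (#|I| <= size l)%N by rewrite leqNgt ltl.
  rewrite cardE -(size_map f); apply: uniq_leq_size.
    rewrite map_inj_uniq ?enum_uniq// => i j fij; apply/eqP/negPn/negP => ij.
    by apply: ninj; exists i, j.
  by move=> _ /mapP[i _ ->]; case: (fP i).
have : rnorm (T (e i) - T (e j)) < r.
  rewrite -(subrKA (f i)) (le_lt_trans (rnormD _ _))// {2}fij [X in _ + X]rnormB.
  by have [[_ ?] [_ ?]] := (fP i, fP j); lra.
apply/negP; rewrite -leNgt -(@ler_pXn2r _ 2)// ?nnegrE ?rnorm_ge0 ?(ltW r0)//.
rewrite rnorm_sqrD rnormN innerNr TT' es innerZr oe (negbTE ij) mulr0 oppr0 mulr0 addr0.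
have sE k : rnorm (T (e k)) ^+ 2 = s k ^+ 2.
  apply: complexI; rewrite -innerxx TT' es innerZr oe eqxx mulr1.
  exact: conjc_real.
have s0 k : r ^+ 2 <= s k ^+ 2.
  by rewrite ler_pXn2r// nnegrE ?(ltW r0)// (le_trans _ (rs k))// ltW.
by rewrite !sE (le_trans (s0 i))// lerDl sqr_ge0.
Qed.

(* Adjoining top eigenvectors of the complement must stop, by the previous bound. *)
Lemma singular_approx T T' (r : R) : compact_pair T T' -> 0 < r ->
  exists (I : finType) (e : I -> H) s, [/\ singular_fam T T' e s, forall i, r <= s i &
    forall x, (forall i, inner x (e i) = 0) -> rnorm (T x) <= r * rnorm x].
Proof.
move=> cT r0; apply: contrapT => nfam.
have [n hn] := singular_fam_bound cT r0.
suff [I [e [s [cI Ie rs]]]] : exists (I : finType) (e : I -> H) s,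
    [/\ #|I| = n.+1, singular_fam T T' e s & forall i, r <= s i].
  by have := hn I e s Ie rs; rewrite cI ltnn.
elim: n.+1 => {hn n}[|n [I [e [s [cI [oe es] rs]]]]].
  exists void, (fun i : void => match i with end), (fun i : void => match i with end).
  by split; [rewrite card_void|split; case|case].
have [x ex rx] : exists2 x, forall i, inner x (e i) = 0 & r * rnorm x < rnorm (T x).
  apply: contrapT => nx; apply: nfam; exists I, e, s; split=> // x ex.
  by rewrite leNgt; apply/negP => rx; apply: nx; exists x.
have [|u [t [rt u1 ue ut]]] := top_eigenvector cT _ r0 ex rx.
  by move=> i; exists (s i ^+ 2)%:C.
exists (option I), (fun o => if o is Some i then e i else u),
  (fun o => if o is Some i then s i else t).
split; first by rewrite card_option cI.
  split; last by case.
  move=> [i|] [j|] //=.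
  - by rewrite innerC ue conjC0.
  - by rewrite innerxx u1 expr1n.
by case.
Qed.

End spectral.

(** * Orthonormal bases of subspaces *)

Section dimension.
Variables (R : realType) (H : hilbertType R).
Implicit Types (E : set H).

Definition lin_subspace E := E 0 /\ forall (a : R[i]) x y, E x -> E y -> E (a *: x + y).

Lemma subspace_sum E (I : finType) (a : I -> R[i]) (F : I -> H) : lin_subspace E ->
  (forall i, E (F i)) -> E (\sum_i a i *: F i).
Proof. by move=> [E0 EZ] EF; elim/big_rec: _ => // i x _ Ex; exact: EZ. Qed.

Lemma orthonormal_lin_indep n (e : 'I_n -> H) : orthonormal_fam e -> lin_indep e.
Proof.
by move=> oe c c0 k; rewrite -(inner_sum_orthonormal oe c k) c0 inner0l.
Qed.

(** [dim] counts independent families, while the estimates need orthonormal ones. With [k < n], the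
    matrix of the products [inner (v i) (e j)] has a nonzero left kernel vector, whose combination
    of the [v i] is a nonzero vector of [E] orthogonal to all [e j]. *)
Lemma lin_indep_orthonormal E n (v : 'I_n -> H) k : lin_subspace E -> lin_indep v ->
  (forall i, E (v i)) -> (k <= n)%N ->
  exists e : 'I_k -> H, orthonormal_fam e /\ forall i, E (e i).
Proof.
move=> sE iv Ev; elim: k => [_|k ih kn].
  by exists (fun=> 0); split=> -[].
have [e [oe Ee]] := ih (ltnW kn).
pose A := \matrix_(i < n, j < k) inner (v i) (e j).
have [c cA c0] : exists2 c : 'rV_n, c *m A = 0 & c != 0.
  have : kermx A != 0.
    by rewrite kermx_eq0 /row_free neq_ltn (leq_ltn_trans (rank_leq_col A)).
  by case/rowV0Pn => c /sub_kermxP ? ?; exists c.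
pose x := \sum_i c 0 i *: v i.
have Ex : E x by exact: subspace_sum.
have xe j : inner x (e j) = 0.
  have /rowP/(_ j) := cA; rewrite !mxE => <-; rewrite inner_suml.
  by apply: eq_bigr => i _; rewrite innerZl mxE.
have x0 : rnorm x != 0.
  apply: contraNneq c0 => /rnorm_eq0 /iv c0; apply/eqP/rowP => i; rewrite mxE.
  exact: c0.
pose u := (rnorm x)^-1%:C *: x.
have uu : inner u u = 1.
  by rewrite innerxx rnormZ rnorm_real ger0_norm ?invr_ge0 ?rnorm_ge0// mulVf// expr1n.
have ue j : inner u (e j) = 0 by rewrite innerZl xe mulr0.
have eu j : inner (e j) u = 0 by rewrite innerC ue conjC0.
exists (fun i => if unlift ord_max i is Some j then e j else u); split.
  move=> i j; case: unliftP => [i' ->|->]; case: unliftP => [j' ->|->].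
  - by rewrite oe (inj_eq lift_inj).
  - by rewrite eu eq_sym (negbTE (neq_lift _ _)).
  - by rewrite ue (negbTE (neq_lift _ _)).
  - by rewrite uu eqxx.
move=> i; case: unliftP => // _; rewrite -[u]addr0.
by case: sE => E0; apply.
Qed.

Lemma le_dim E n (e : 'I_n -> H) : orthonormal_fam e -> (forall i, E (e i)) ->
  (n%:R%:E <= Defs.dim E)%E.
Proof.
move=> oe Ee; apply: ereal_sup_ubound; exists n => //; exists e; split=> //.
exact: orthonormal_lin_indep.
Qed.

Lemma bounded_dim E N : lin_subspace E ->
  (forall n (e : 'I_n -> H), orthonormal_fam e -> (forall i, E (e i)) -> (n <= N)%N) ->
  exists n (e : 'I_n -> H),
    [/\ Defs.dim E = n%:R%:E, orthonormal_fam e & forall i, E (e i)].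
Proof.
move=> sE bE.
pose P n := `[< exists e : 'I_n -> H, orthonormal_fam e /\ forall k, E (e k) >].
have exP : exists n, P n by exists 0; apply/asboolP; exists (fun=> 0); split=> -[].
have PN n : P n -> (n <= N)%N by move=> /asboolP[e [oe Ee]]; exact: bE Ee.
case: (ex_maxnP exP PN) => n /asboolP[e [oe Ee]] nmax.
exists n, e; split=> //; apply/eqP; rewrite eq_le (le_dim oe Ee) andbT.
apply: ge_ereal_sup => _ [k [v [iv Ev]] <-]; rewrite lee_fin ler_nat nmax//.
by apply/asboolP; exact: (lin_indep_orthonormal sE iv Ev).
Qed.

End dimension.

(** * Sums of powers of singular values *)

Section schatten_sum.
Variables (R : realType) (H : hilbertType R).
Implicit Types (T : H -> H) (q : R).

Definition schatten_sum q T : \bar R :=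
  (\esum_(s in [set s : R | (0 < s)%R]) (singular_mult T s * (s `^ q)%:E))%E.

Lemma eigenspace_lin_subspace T T' (c : R[i]) : adjoint_pair T T' ->
  lin_subspace (Defs.eigenspace (T' \o T) c).
Proof.
move=> TT'; have T'T := adjoint_pairC TT'.
rewrite /lin_subspace /Defs.eigenspace; split=> /=.
  by rewrite (adjoint_lin0 TT') (adjoint_lin0 T'T) scaler0.
move=> a x y Ex Ey.
rewrite (adjoint_linD TT') (adjoint_linZ TT') (adjoint_linD T'T) (adjoint_linZ T'T).
by rewrite Ex Ey scalerDr !scalerA mulrC.
Qed.

Lemma eigenspace_ortho T T' (c d : R) x y : adjoint_pair T T' -> c != d ->
  T' (T x) = c%:C *: x -> T' (T y) = d%:C *: y -> inner x y = 0.
Proof.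
move=> TT' cd xc yd; apply/eqP.
have : (c%:C - d%:C) * inner x y = 0.
  rewrite mulrBl -innerZl -xc (adjoint_pairC TT') TT' yd innerZr.
  by rewrite [Num.conj _]conjc_real subrr.
by move/eqP; rewrite mulf_eq0 subr_eq0 => /orP[/eqP[] /eqP|//]; rewrite (negbTE cd).
Qed.

Lemma singular_fam_cat T T' (I J : finType) (e : I -> H) (s : I -> R)
    (e' : J -> H) (s' : J -> R) :
  adjoint_pair T T' -> singular_fam T T' e s -> singular_fam T T' e' s' ->
  (forall i, 0 < s i) -> (forall j, 0 < s' j) -> (forall i j, s i != s' j) ->
  singular_fam T T' (fun k : I + J => match k with inl i => e i | inr j => e' j end)
    (fun k => match k with inl i => s i | inr j => s' j end).
Proof.
move=> TT' [oe es] [oe' es'] s0 s'0 ss'; split; last by case.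
have ee' i j : inner (e i) (e' j) = 0.
  apply: (eigenspace_ortho TT' _ (es i) (es' j)).
  by rewrite eqrXn2 ?ltW.
by move=> [i|j] [i'|j'] //; rewrite innerC ee' conjC0.
Qed.

(** Eigenspaces for distinct positive values are orthogonal, so bases chosen in each of them
    concatenate. This turns a finite partial sum weighted by multiplicities into a sum over one
    singular family. *)
Lemma singular_fam_glue T T' (r : seq R) (n : R -> nat) :
  adjoint_pair T T' -> uniq r -> (forall x, x \in r -> 0 < x) ->
  (forall x, x \in r -> exists e : 'I_(n x) -> H,
    orthonormal_fam e /\ forall i, T' (T (e i)) = (x ^+ 2)%:C *: e i) ->
  exists (I : finType) (e : I -> H) s, [/\ singular_fam T T' e s, forall i, s i \in r &
    forall F : R -> R, \sum_i F (s i) = \sum_(x <- r) (n x)%:R * F x].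
Proof.
move=> TT'; elim: r => [_ _ _|x r ih /= /andP[xr ur] r0 hr].
  exists void, (fun i : void => match i with end), (fun i : void => match i with end).
  by split; [split; case|case|move=> F; rewrite big_nil big_pred0// => -[]].
have [||I [e [s [Ie sr Fs]]]] := ih ur.
- by move=> y yr; rewrite r0// inE yr orbT.
- by move=> y yr; apply: hr; rewrite inE yr orbT.
have [d [od Ed]] := hr x (mem_head _ _).
exists ('I_(n x) + I)%type, (fun k => match k with inl i => d i | inr j => e j end),
  (fun k => match k with inl i => x | inr j => s j end); split.
- apply: (singular_fam_cat TT') => //.
  + by move=> i; rewrite r0// mem_head.
  + by move=> j; rewrite r0// inE sr orbT.
  + by move=> i j; apply: contraNneq xr => ->.
- by case=> [i|j]; rewrite inE ?eqxx ?sr ?orbT.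
- by move=> F; rewrite big_sumType /= Fs big_cons sumr_const card_ord mulr_natl.
Qed.

(** Group the indices by the value of [s]: each group is orthonormal in one eigenspace, hence no
    larger than the multiplicity. *)
Lemma singular_fam_le_sum T T' q (I : finType) (e : I -> H) s :
  adjoint_pair T T' -> singular_fam T T' e s -> (forall i, 0 < s i) ->
  ((\sum_i s i `^ q)%:E <= schatten_sum q T)%E.
Proof.
move=> TT' [oe es] s0; pose r := undup (codom s).
have ur : uniq r by exact: undup_uniq.
apply: esum_ge; exists [set` r].
  split; first exact: finite_seq.
  by move=> x /=; rewrite mem_undup => /codomP[i ->].
rewrite -fsbig_seq//.
have -> : \sum_i s i `^ q = \sum_(x <- r) #|[pred i | s i == x]|%:R * x `^ q.
  transitivity (\sum_i \sum_(x <- r | s i == x) x `^ q).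
    apply: eq_bigr => i _; rewrite (eq_bigl (pred1 (s i))); last first.
      by move=> x; rewrite /= eq_sym.
    by rewrite -big_filter filter_pred1_uniq// ?big_seq1// mem_undup codom_f.
  rewrite (exchange_big_dep xpredT)//=; apply: eq_bigr => x _.
  by rewrite sumr_const mulr_natl.
rewrite -sumEFin; apply: lee_sum => x _; rewrite EFinM lee_wpmul2r ?lee_fin ?powR_ge0//.
rewrite /singular_mult (adjoint_pairE TT').
apply: (@le_dim _ _ _ _ (fun k => e (enum_val k))).
  by move=> i j; rewrite oe (inj_eq enum_val_inj).
by move=> k; have := enum_valP k; rewrite inE /Defs.eigenspace /= es => /eqP ->.
Qed.

Lemma schatten_sum_le T T' q (a : R) : adjoint_pair T T' ->
  (forall (I : finType) (e : I -> H) s, singular_fam T T' e s -> (forall i, 0 < s i) ->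
     \sum_i s i `^ q <= a) -> (schatten_sum q T <= a%:E)%E.
Proof.
move=> TT' fa.
pose E x := Defs.eigenspace (T' \o T) (x ^+ 2)%:C.
have bE x : 0 < x -> exists N, forall n (e : 'I_n -> H), orthonormal_fam e ->
    (forall i, E x (e i)) -> (n <= N)%N.
  (* The hypothesis itself makes eigenspaces finite-dimensional: [n] orthonormal eigenvectors for
     [x] contribute [n * x ^ q], at most [a]. The empty family gives [0 <= a]. *)
  move=> x0; exists (Num.truncn (a / x `^ q)) => n e oe Ee.
  have xq : 0 < x `^ q by rewrite powR_gt0.
  rewrite truncn_ge_nat; last first.
    have := fa 'I_0 (fun=> 0) (fun=> 1); rewrite big_ord0 => a0.
    by rewrite divr_ge0 ?(ltW xq)// a0//; split; case.
  rewrite ler_pdivlMr//; have := fa _ e (fun=> x) (conj oe Ee) (fun=> x0).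
  by rewrite sumr_const card_ord mulr_natl.
have /choice[n nP] : forall x, exists n, 0 < x -> singular_mult T x = n%:R%:E /\
    exists e : 'I_n -> H, orthonormal_fam e /\ forall i, E x (e i).
  move=> x; have [x0|x0] := ltP 0 x; last by exists 0.
  have [N hN] := bE x x0.
  have [n [e [dE oe Ee]]] := bounded_dim (eigenspace_lin_subspace (x ^+ 2)%:C TT') hN.
  exists n => _; split; last by exists e.
  by rewrite /singular_mult (adjoint_pairE TT').
apply: ge_ereal_sup => _ [X [finX X0] <-].
rewrite fsbig_finite//=; set r := enum_fset (fset_set X).
have r0 x : x \in r -> 0 < x by rewrite in_fset_set// inE => /X0.
have [|I [e [s [es sr Fs]]]] := singular_fam_glue (n := n) TT' (fset_uniq _) r0.
  by move=> x /r0 /nP[].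
have -> : (\sum_(x <- r) singular_mult T x * (x `^ q)%:E =
    (\sum_(x <- r) (n x)%:R * x `^ q)%:E)%E.
  rewrite -sumEFin !big_seq; apply: eq_bigr => x /r0 /nP[-> _].
  by rewrite EFinM.
by rewrite lee_fin -(Fs (fun x => x `^ q)); apply: (fa _ e) => // i; rewrite r0.
Qed.

End schatten_sum.

(** * Schatten norms *)

Section schatten_norm.
Variables (R : realType) (H : hilbertType R).
Implicit Types (S T : H -> H) (q a : R).

Definition form_bound q T a := forall (I : finType) (e f : I -> H),
  orthonormal_fam e -> orthonormal_fam f ->
  \sum_i rnorm (inner (T (e i)) (f i)) `^ q <= a `^ q.

Lemma rnorm_innerC (x y : H) : rnorm (inner x y) = rnorm (inner y x).
Proof. by rewrite innerC rnorm_conj. Qed.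

Lemma besselC (I : finType) (e : I -> H) : orthonormal_fam e -> forall x,
  \sum_i rnorm (inner (e i) x) ^+ 2 <= rnorm x ^+ 2.
Proof. by move=> oe x; under eq_bigr do rewrite rnorm_innerC; exact: bessel. Qed.

Lemma singular_mult_ge0 T (s : R) : (0 <= singular_mult T s)%E.
Proof. by apply: (@le_dim _ _ _ 0 (fun=> 0)) => -[]. Qed.

Lemma schatten_sum_ge0 q T : (0 <= schatten_sum q T)%E.
Proof.
by apply: esum_ge0 => s _; rewrite mule_ge0 ?singular_mult_ge0// lee_fin powR_ge0.
Qed.

Lemma schatten_norm_ge0 q T : (0 <= schatten_norm q T)%E.
Proof. exact: poweR_ge0. Qed.

Lemma schatten_norm_le q T a : 0 < q -> 0 <= a ->
  (schatten_norm q T <= a%:E)%E = (schatten_sum q T <= (a `^ q)%:E)%E.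
Proof.
move=> q0 a0; have qn0 : q != 0 by rewrite gt_eqF.
have in0 (x : \bar R) : (0 <= x)%E -> x \in `[0%E, +oo%E].
  by move=> x0; rewrite in_itv /= x0 leey.
rewrite /schatten_norm -/(schatten_sum q T); apply/idP/idP => h.
  have := @gt0_ler_poweR _ q (ltW q0) _ _ (in0 _ (poweR_ge0 _ _)) (in0 a%:E _) h.
  by rewrite -poweRrM mulVf// poweRe1 ?schatten_sum_ge0//; apply; rewrite lee_fin.
have := @gt0_ler_poweR _ q^-1 _ _ _ (in0 _ (schatten_sum_ge0 q T)) (in0 (a `^ q)%:E _) h.
rewrite poweR_EFin -powRrM mulfV// powRr1//; apply; first by rewrite invr_ge0 ltW.
by rewrite lee_fin powR_ge0.
Qed.

(** These are the left singular vectors. Pairing [T (e i)] with them returns [s i], so they are the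
    test family that recovers the norm from [form_bound]. *)
Lemma singular_fam_polar T T' (I : finType) (e : I -> H) s : adjoint_pair T T' ->
  singular_fam T T' e s -> (forall i, 0 < s i) ->
  orthonormal_fam (fun i => (s i)^-1%:C *: T (e i)).
Proof.
move=> TT' [oe es] s0 i j; rewrite innerZl innerZr TT' es innerZr oe.
rewrite ![Num.conj _]conjc_real; have [->|] := eqVneq i j; last by rewrite !mulr0.
have s1 : (s j)^-1 * ((s j)^-1 * s j ^+ 2) = 1.
  by have := s0 j => sj; field; rewrite gt_eqF.
by rewrite mulr1 -!rmorphM /= s1.
Qed.

Lemma form_bound_schatten_norm q T T' a : adjoint_pair T T' -> 0 < q -> 0 <= a ->
  form_bound q T a -> (schatten_norm q T <= a%:E)%E.
Proof.
move=> TT' q0 a0 qTa; rewrite schatten_norm_le//.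
apply: (schatten_sum_le TT') => I e s Ie s0.
have [oe es] := Ie; have := qTa I _ _ oe (singular_fam_polar TT' Ie s0).
rewrite (eq_bigr (fun i => s i `^ q))// => i _.
rewrite innerZr TT' es innerZr oe eqxx mulr1 ![Num.conj _]conjc_real -rmorphM /=.
by rewrite rnorm_real expr2 mulrA mulVf ?gt_eqF// mul1r ger0_norm// ltW.
Qed.

(* Up to an error [r], [<T e_k, f_k>] is [sum_i s_i <e_k, u_i> <v_i, f_k>], a
   sum of the [s_i] whose weights have row and column sums at most 1 by Bessel. *)
Lemma schatten_norm_form_bound q T T' a : compact_pair T T' -> 1 <= q -> 0 < a ->
  (schatten_norm q T <= a%:E)%E -> form_bound q T a.
Proof.
move=> cT q1 a0; have q0 : 0 < q by lra.
have [TT' _] := cT.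
rewrite schatten_norm_le ?(ltW a0)// => sa I e f oe of_.
set c := fun i => rnorm (inner (T (e i)) (f i)).
(* Minkowski absorbs the error [r] of each term: the constant family [r] has q-norm at most
   [(#|I| + 1) * r], where the added 1 keeps the bound positive for empty [I] and the factor at
   least 1. *)
have approx r : 0 < r -> \sum_i c i `^ q <= (a + (#|I|%:R + 1) * r) `^ q.
  move=> r0; have [J [u [s [Ju rs ur]]]] := singular_approx cT r0.
  have s0 i : 0 < s i by rewrite (lt_le_trans r0).
  have [ou us] := Ju.
  have [v [ov Tu]] : exists v, orthonormal_fam v /\ forall i, T (u i) = (s i)%:C *: v i.
    exists (fun i => (s i)^-1%:C *: T (u i)); split.
      exact: singular_fam_polar Ju s0.
    by move=> i; rewrite scalerA -rmorphM /= mulfV ?gt_eqF// scale1r.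
  (* This mean dominates the product of the two moduli, and Bessel controls its sums over [i] as
     well as over [k]. Jensen along rows followed by the column bound then compares [b] with [s]. *)
  pose w k i := (rnorm (inner (e k) (u i)) ^+ 2 + rnorm (inner (f k) (v i)) ^+ 2) / 2.
  have w0 k i : 0 <= w k i by rewrite divr_ge0// addr_ge0// exprn_ge0// rnorm_ge0.
  pose b k := \sum_i w k i * s i.
  have b0 k : 0 <= b k by apply: sumr_ge0 => i _; rewrite mulr_ge0// ltW.
  have cb k : c k <= b k + r.
    rewrite /c -[e k](subrK (\sum_i inner (e k) (u i) *: u i)) -/(proj_compl u (e k)).
    rewrite (adjoint_linD TT') innerDl addrC (le_trans (rnormD _ _))// lerD//.
      rewrite (adjoint_lin_sum TT') inner_suml.
      rewrite (le_trans (rnorm_sum _))// ler_sum// => i _.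
      rewrite (adjoint_linZ TT') Tu !innerZl !rnormM rnorm_real ger0_norm ?(ltW (s0 i))//.
      rewrite mulrCA mulrC.
      rewrite ler_wpM2r ?(ltW (s0 i))// /w [rnorm (inner (v i) _)]rnorm_innerC.
      have := sqr_ge0 (rnorm (inner (e k) (u i)) - rnorm (inner (f k) (v i))); nra.
    rewrite (le_trans (cauchy_schwarz _ _))// (orthonormal_rnorm of_) mulr1.
    rewrite (le_trans (ur _ _))//; first by move=> i; exact: proj_compl_ortho.
    rewrite ler_piMr ?(ltW r0)// (le_trans (proj_compl_le ou _))//.
    by rewrite (orthonormal_rnorm oe).
  have bq : \sum_k b k `^ q <= a `^ q.
    have sa' : \sum_i s i `^ q <= a `^ q.
      by rewrite -lee_fin (le_trans (singular_fam_le_sum q TT' Ju s0)).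
    have wrow k : \sum_i w k i <= 1.
      rewrite -mulr_suml big_split /= ler_pdivrMr// mul1r.
      have := bessel ou (e k); have := bessel ov (f k).
      by rewrite (orthonormal_rnorm oe) (orthonormal_rnorm of_) expr1n; lra.
    have wcol i : \sum_k w k i <= 1.
      rewrite -mulr_suml big_split /= ler_pdivrMr// mul1r.
      have := besselC oe (u i); have := besselC of_ (v i).
      by rewrite (orthonormal_rnorm ou) (orthonormal_rnorm ov) expr1n; lra.
    apply: le_trans sa'.
    apply: (@le_trans _ _ (\sum_k \sum_i w k i * s i `^ q)).
      by apply: ler_sum => k _; apply: powR_jensen => // i; exact: ltW.
    rewrite exchange_big /=; apply: ler_sum => i _; rewrite -mulr_suml.
    by rewrite ler_piMl// powR_ge0.
  apply: (@le_trans _ _ (\sum_k (b k + r) `^ q)).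
    apply: ler_sum => k _; apply: ge0_ler_powR; rewrite ?nnegrE ?(ltW q0)//.
      exact: rnorm_ge0.
    by rewrite addr_ge0// ltW.
  have I1 : 1 <= #|I|%:R + 1 :> R by rewrite lerDr.
  apply: powR_minkowski => //.
  - by move=> i; exact: ltW.
  - by rewrite mulr_gt0// (lt_le_trans _ I1).
  rewrite sumr_const -[leLHS]mulr_natl powRM ?(ltW r0) ?(le_trans _ I1)//.
  rewrite ler_wpM2r ?powR_ge0// (@le_trans _ _ (#|I|%:R + 1))// ?lerDl//.
  by rewrite -[leLHS]powRr1 ?addr_ge0// ler_powR.
have qn0 : q != 0 by rewrite gt_eqF.
have sum0 : 0 <= \sum_i c i `^ q by apply: sumr_ge0 => i _; exact: powR_ge0.
have : (\sum_i c i `^ q) `^ q^-1 <= a.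
  rewrite -subr_le0; apply: (@le0_small _ _ (#|I|%:R + 1)); first by rewrite addr_ge0.
  move=> r r0; rewrite lerBlDl.
  have h0 : 0 <= a + (#|I|%:R + 1) * r.
    by rewrite addr_ge0 ?(ltW a0)// mulr_ge0 ?(ltW r0)// addr_ge0.
  rewrite (_ : a + _ = ((a + (#|I|%:R + 1) * r) `^ q) `^ q^-1).
    by apply: ge0_ler_powR (approx r r0); rewrite ?nnegrE ?powR_ge0 ?invr_ge0 ?(ltW q0).
  by rewrite -powRrM mulfV// powRr1.
move=> h; rewrite (_ : \sum_i _ = ((\sum_i c i `^ q) `^ q^-1) `^ q).
  by apply: ge0_ler_powR h; rewrite ?nnegrE ?powR_ge0 ?(ltW q0) ?(ltW a0).
by rewrite -powRrM mulVf// powRr1.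
Qed.

(** Restricting to positive real bounds handles an infinite norm for free, and a zero norm by
    approximation from above. *)
Lemma lee_of_bounds (x y : \bar R) : (0 <= x)%E ->
  (forall a, 0 < a -> (x <= a%:E)%E -> (y <= a%:E)%E) -> (y <= x)%E.
Proof.
case: x => [x| |] // x0 h; last exact: leey.
apply/lee_addgt0Pr => d d0; rewrite -EFinD; apply: h; last by rewrite lee_fin lerDl ltW.
by rewrite ltr_wpDl.
Qed.

Lemma schatten_normC q T T' : compact_pair T T' -> 1 <= q ->
  (schatten_norm q T' <= schatten_norm q T)%E.
Proof.
move=> cT q1; have q0 : 0 < q by lra.
apply: lee_of_bounds; first exact: schatten_norm_ge0.
move=> a a0 /(schatten_norm_form_bound cT q1 a0) Ta.
have [TT' _] := cT; have T'T := adjoint_pairC TT'.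
apply: (form_bound_schatten_norm T'T q0 (ltW a0)) => I e f oe of_.
rewrite (eq_bigr (fun i => rnorm (inner (T (f i)) (e i)) `^ q)) ?Ta// => i _.
by rewrite T'T rnorm_innerC.
Qed.

Lemma schatten_normZ q T T' (c : R[i]) : compact_pair T T' -> 1 <= q -> 0 < rnorm c ->
  (schatten_norm q (c \*: T) <= (rnorm c)%:E * schatten_norm q T)%E.
Proof.
move=> cT q1 c0; have q0 : 0 < q by lra.
apply: lee_of_bounds; first by rewrite mule_ge0 ?schatten_norm_ge0// lee_fin ltW.
move=> a a0; rewrite muleC -lee_pdivlMr// -EFinM.
have ac0 : 0 < a / rnorm c by rewrite divr_gt0.
move=> /(schatten_norm_form_bound cT q1 ac0) Ta.
have [/(adjoint_pairZ c) TT' _] := cT.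
apply: (form_bound_schatten_norm TT' q0 (ltW a0)) => I e f oe of_.
have -> : a `^ q = rnorm c `^ q * (a / rnorm c) `^ q.
  by rewrite -powRM ?ltW// mulrC divfK// gt_eqF.
rewrite (eq_bigr (fun i => rnorm c `^ q * rnorm (inner (T (e i)) (f i)) `^ q)).
  by rewrite -mulr_sumr ler_wpM2l ?powR_ge0// Ta.
by move=> i _; rewrite /= innerZl rnormM powRM ?rnorm_ge0.
Qed.

Lemma schatten_normD q S S' T T' : compact_pair S S' -> compact_pair T T' -> 1 <= q ->
  (schatten_norm q (S \+ T)%R <= schatten_norm q S + schatten_norm q T)%E.
Proof.
move=> cS cT q1; have q0 : 0 < q by lra.
have [SS' _] := cS; have [TT' _] := cT; have ST := adjoint_pairD SS' TT'.
have := schatten_norm_ge0 q S; have := schatten_norm_ge0 q T.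
case ES: (schatten_norm q S) => [s| |]; case ET: (schatten_norm q T) => [t| |] // t0 s0;
  rewrite ?leey//.
apply/lee_addgt0Pr => d d0; rewrite -!EFinD.
(* Minkowski needs positive bounds while a norm may vanish, hence the slack [d / 2] on each side. *)
have d2 : 0 < d / 2 by rewrite divr_gt0.
rewrite !lee_fin in s0 t0.
have [sd td] : 0 < s + d / 2 /\ 0 < t + d / 2 by split; rewrite ltr_wpDl.
have := schatten_norm_form_bound cS q1 sd; rewrite ES lee_fin lerDl => /(_ (ltW d2)) Sb.
have := schatten_norm_form_bound cT q1 td; rewrite ET lee_fin lerDl => /(_ (ltW d2)) Tb.
have -> : s + t + d = (s + d / 2) + (t + d / 2) by field.
apply: (form_bound_schatten_norm ST q0); first by rewrite addr_ge0 ?ltW.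
move=> I e f oe of_.
apply: le_trans (powR_minkowski q1 _ _ sd td (Sb I e f oe of_) (Tb I e f oe of_)).
- apply: ler_sum => i _.
  apply: ge0_ler_powR; rewrite ?nnegrE ?(ltW q0) ?addr_ge0 ?rnorm_ge0//.
  by rewrite innerDl rnormD.
- by move=> i; exact: rnorm_ge0.
- by move=> i; exact: rnorm_ge0.
Qed.

(* [P^2 x = c^2 x] means [(P + c)(P - c) x = 0], and [P + c] is injective. *)
Lemma eigenspace_sqr T T' (c : R) : adjoint_pair T T' -> 0 < c ->
  Defs.eigenspace ((T' \o T) \o (T' \o T)) (c ^+ 2)%:C = Defs.eigenspace (T' \o T) c%:C.
Proof.
move=> TT' c0; have T'T := adjoint_pairC TT'.
apply/seteqP; split => x; rewrite /Defs.eigenspace /= => Px.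
  pose y := T' (T x) - c%:C *: x.
  have Py : T' (T y) = - (c%:C *: y).
    rewrite /y (adjoint_linB TT') (adjoint_linB T'T).
    rewrite (adjoint_linZ TT') (adjoint_linZ T'T) Px.
    by rewrite scalerBr opprB scalerA -rmorphM.
  apply/eqP; rewrite -subr_eq0 -/y; apply/eqP/rnorm_eq0.
  have : inner (T' (T y)) y = inner (T y) (T y) by rewrite T'T.
  rewrite Py innerNl innerZl !innerxx -rmorphM -rmorphN /= => -[h].
  have y0 : rnorm y ^+ 2 <= 0.
    have := sqr_ge0 (rnorm (T y)); rewrite -h oppr_ge0 => h0.
    by rewrite -(pmulr_rle0 _ c0).
  apply/eqP; rewrite -sqrf_eq0; apply/eqP; apply/eqP; rewrite eq_le y0 sqr_ge0//.
by rewrite Px (adjoint_linZ TT') (adjoint_linZ T'T) Px scalerA rmorphXn.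
Qed.

(** The singular values of [T' \o T] are the squares of those of [T], with the same multiplicities.
    Reindexing by [s ^+ 2] identifies the two sums, and the outer exponents [2 / p] and [1 / p]
    produce the square. *)
Lemma schatten_norm_sqr p T T' : adjoint_pair T T' -> 0 < p ->
  schatten_norm (p / 2) (T' \o T) = (schatten_norm p T ^+ 2)%E.
Proof.
move=> TT' p0; have T'T := adjoint_pairC TT'.
have aP : adjoint (T' \o T) = T' \o T by apply/adjoint_pairE/adjoint_pair_comp.
have sumE : schatten_sum (p / 2) (T' \o T) = schatten_sum p T.
  rewrite /schatten_sum.
  rewrite (@reindex_esum _ _ _ [set s : R | 0 < s] _ (fun s => s ^+ 2)); last first.
    split=> [s /= s0|s t|s /= s0].
    - by rewrite exprn_gt0.
    - rewrite !inE /= => s0 t0 /eqP; rewrite eqrXn2 ?(ltW s0) ?(ltW t0)// => /eqP//.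
    - by exists (Num.sqrt s); [rewrite /= sqrtr_gt0|rewrite sqr_sqrtr// ltW].
  apply: eq_esum => s /= s0; congr (_ * _)%E.
    by rewrite /singular_mult aP (adjoint_pairE TT') eigenspace_sqr// exprn_gt0.
  by rewrite -powR_mulrn ?(ltW s0)// -powRrM mulrC divfK.
rewrite /schatten_norm -!/(schatten_sum _ _) sumE invf_div.
have := schatten_sum_ge0 p T; case: (schatten_sum p T) => [x| |] // x0.
  rewrite !poweR_EFin -EFin_expe -powR_mulrn ?powR_ge0// -powRrM.
  by congr (x `^ _)%:E; rewrite mulrC.
rewrite !poweRyr ?gt_eqF// ?invr_gt0 ?divr_gt0//.
Qed.

End schatten_norm.

(** * Real and imaginary parts *)

Section real_part.
Variables (R : realType) (H : hilbertType R).
Implicit Types (S T A : H -> H) (t q : R).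

Lemma re_opE T T' : adjoint_pair T T' -> re_op T = 2^-1 \*: (T \+ T').
Proof. by rewrite /re_op => /adjoint_pairE ->. Qed.

Lemma compact_pair_re_op T T' : compact_pair T T' -> compact_pair (re_op T) (re_op T).
Proof.
move=> cT; have [TT' _] := cT.
have := compact_pairZ 2^-1 (compact_pairD cT (compact_pairC cT)).
rewrite (re_opE TT') (_ : Num.conj 2^-1 \*: (T' \+ T) = 2^-1 \*: (T \+ T'))//.
by apply/funext => x /=; rewrite addrC fmorphV rmorph_nat.
Qed.

Lemma expiM t : Num.conj (expi t) * expi t = 1.
Proof.
rewrite mulrC -rnorm_sqr /rnorm normc_def /= cos2Dsin2 sqrtr1 expr1n.
by [].
Qed.

Lemma expiD t : expi (t + t) = expi t ^+ 2.
Proof.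
rewrite /expi cosD sinD expr2; apply/eqP; rewrite eq_complex /= -!expr2 eqxx /=.
by apply/eqP; ring.
Qed.

Lemma expi_subpi2 t : expi (t - pi / 2) = - 'i%C * expi t.
Proof.
rewrite /expi cosB sinB cos_pihalf sin_pihalf; apply/eqP; rewrite eq_complex /=.
by apply/andP; split; apply/eqP; ring.
Qed.

Lemma im_op_expi A A' t : adjoint_pair A A' ->
  im_op (expi t \*: A) = re_op (expi (t - pi / 2) \*: A).
Proof.
move=> AA'; have AtA' s := adjoint_pairZ (expi s) AA'.
rewrite (re_opE (AtA' _)) /im_op (adjoint_pairE (AtA' _)) expi_subpi2.
apply/funext => x /=; rewrite scalerBr scalerDr !scalerA.
rewrite rmorphM rmorphN /= -scaleNr.
have -> : Num.conj 'i%C = - 'i%C :> R[i] by apply/eqP; rewrite eq_complex /= oppr0 !eqxx.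
have i2 : (2 * 'i%C)^-1 = - 'i%C / 2 :> R[i].
  have i0 : 'i%C != 0 :> R[i] by rewrite eq_complex /= eqxx oner_eq0.
  have ii : 'i%C * 'i%C = - 1 :> R[i] by rewrite -expr2 sqr_i.
  rewrite invfM mulrC; congr (_ * _); apply: (mulfI i0).
  by rewrite mulfV// mulrN ii opprK.
by rewrite i2; congr (_ *: _ + _ *: _); ring.
Qed.

Lemma re_op_sqr A A' t : adjoint_pair A A' ->
  re_op (expi t \*: A) \o re_op (expi t \*: A) =
  (2^-1 \*: re_op (expi (t + t) \*: (A \o A))) \+ (4^-1 \*: ((A' \o A) \+ (A \o A'))).
Proof.
move=> AA'; have A'A := adjoint_pairC AA'.
rewrite (re_opE (adjoint_pairZ _ AA')).
rewrite (re_opE (adjoint_pairZ _ (adjoint_pair_comp AA' AA'))) expiD rmorphXn /=.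
apply/funext => x /=; move: (expiM t); set w := expi t; set w' := Num.conj w => w1.
rewrite !(adjoint_linD AA', adjoint_linD A'A, adjoint_linZ AA', adjoint_linZ A'A).
rewrite !(scalerDr, scalerA).
have E4 : 4^-1 = 2^-1 * 2^-1 :> R[i] by rewrite -invfM -natrM.
rewrite E4 -!expr2 -!addrA; congr (_ + _).
  by congr (_ *: _); ring.
have ww' : 2^-1 ^+ 2 = 2^-1 ^+ 2 * (w' * w) by rewrite w1 mulr1.
rewrite [RHS]addrC -[RHS]addrA [RHS]addrCA; congr (_ *: _ + (_ *: _ + _ *: _)).
- by rewrite [RHS]ww'; ring.
- by rewrite [RHS]ww'; ring.
- by ring.
Qed.

(** Add [re_op_sqr] at [t] and at [t - pi / 2]: doubling the angles makes the two phases opposite,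
    so the terms in [A \o A] cancel. *)
Lemma re_op_sqrD A A' t : adjoint_pair A A' ->
  (A' \o A) \+ (A \o A') = 2 \*: ((re_op (expi t \*: A) \o re_op (expi t \*: A)) \+
  (im_op (expi t \*: A) \o im_op (expi t \*: A))).
Proof.
move=> AA'; rewrite (im_op_expi _ AA') !(re_op_sqr _ AA').
have AAt s := adjoint_pairZ (expi s) (adjoint_pair_comp AA' AA').
rewrite !(re_opE (AAt _)).
have -> : expi (t - pi / 2 + (t - pi / 2)) = - expi (t + t).
  by rewrite !expiD expi_subpi2 exprMn sqrrN sqr_i mulN1r.
apply/funext => x /=; set u := A' (A x) + A (A' x).
rewrite rmorphN !scaleNr -opprD !scalerN addrACA subrr add0r -scalerDl scalerA.
rewrite [X in X *: _](_ : _ = 1) ?scale1r// -mulr2n -[4^-1 *+ 2]mulr_natl mulrA -natrM.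
by rewrite mulfV// pnatr_eq0.
Qed.

End real_part.

(** * Order estimates in the extended reals *)

Section extended_reals.
Variable R : realType.
Local Open Scope ereal_scope.

(** The numerical radius is squared after the supremum, whereas the operator identities bound each
    square; a real [z] allows a square root in between. *)
Lemma ereal_sup_sqr_le (X : set (\bar R)) (z : R) : X !=set0 ->
  (forall x, X x -> 0 <= x) ->
  (forall x, X x -> x ^+ 2 <= z%:E) -> ereal_sup X ^+ 2 <= z%:E.
Proof.
move=> [x1 Xx1] X0 Xz.
have z0 : (0 <= z)%R by rewrite -lee_fin (le_trans _ (Xz _ Xx1))// expe_ge0// X0.
have h : ereal_sup X <= (Num.sqrt z)%:E.
  apply: ge_ereal_sup => x Xx; have := X0 x Xx; have := Xz x Xx.
  case: x {Xx} => [x| |] //; rewrite -EFin_expe !lee_fin => xz x0.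
  by rewrite -[leLHS]ger0_norm// -sqrtr_sqr ler_wsqrtr.
have s0 : 0 <= ereal_sup X by rewrite (le_trans (X0 _ Xx1))// ereal_sup_ubound.
move: s0 h; case: (ereal_sup X) => [s| |] //; rewrite -EFin_expe !lee_fin => s0 h.
by rewrite -[leRHS]sqr_sqrtr// ler_pXn2r// nnegrE sqrtr_ge0.
Qed.

(** Half the distance is the maximum minus the mean; the maximum is at most [w], and the mean is at
    least [n / 4]. Finiteness of [n] settles the case of infinite [w]. *)
Lemma lee_half_dist (x y w n : \bar R) : 0 <= x -> 0 <= y -> x <= w -> y <= w ->
  0 <= n -> n < +oo -> n <= 2%:E * (x + y) ->
  `|x - y| * (2^-1)%:E <= w - (4^-1)%:E * n.
Proof.
case: n => [n| |] //; case: w => [w| |].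
- case: x => [x| |] //; case: y => [y| |] //; rewrite !lee_fin => x0 y0 xw yw n0 _ nxy.
  by have [xy|xy] := lerP 0 (x - y)%R; [rewrite ger0_norm//|rewrite ltr0_norm//]; lra.
- by move=> *; rewrite -EFinM addye ?leey.
- by case: x.
Qed.

End extended_reals.

Unset Implicit Arguments.
Set Strict Implicit.

Local Open Scope ereal_scope.

Theorem theorem5p7 (R : realType) (H : hilbertType R) (hH : separable H)
    (p : R) (hp : (2 <= p)%R) (A : H -> H) (hA : schatten_class p A) :
  ereal_sup [set
      `| schatten_norm (p / 2) (re_op (expi t \*: A)%R \o re_op (expi t \*: A)%R)
         - schatten_norm (p / 2)
             (im_op (expi t \*: A)%R \o im_op (expi t \*: A)%R) |
      * (2^-1)%:E | t in [set: R]]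
    <= schatten_numrad p A ^+ 2 -
         (4^-1)%:E *
           schatten_norm (p / 2) ((adjoint A \o A) \+ (A \o adjoint A))%R
    <= (2^-1)%:E * schatten_numrad (p / 2) (A \o A).
Proof.
have [linA /(compact_adjoint linA) cA finA] := hA.
have p0 : (0 < p)%R by lra.
have q1 : (1 <= p / 2)%R by lra.
have cA' := compact_pairC cA; have [AA' _] := cA; have [A'A _] := cA'.
have bA := compact_pair_bounded cA; have bA' := compact_pair_bounded cA'.
have cRe t : compact_pair (re_op (expi t \*: A)%R) (re_op (expi t \*: A)%R).
  exact: compact_pair_re_op (compact_pairZ _ cA).
have cRe2 t : compact_pair (re_op (expi t \*: (A \o A))%R)
    (re_op (expi t \*: (A \o A))%R).
  exact: compact_pair_re_op (compact_pairZ _ (compact_pair_compl cA AA' bA)).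
have cA'A := compact_pair_compl cA A'A bA'; have cAA' := compact_pair_compl cA' AA' bA.
have cRe_sqr t :=
  compact_pair_compl (cRe t) (proj1 (cRe t)) (compact_pair_bounded (cRe t)).
set N := schatten_norm (p / 2) ((adjoint A \o A) \+ (A \o adjoint A))%R.
have N0 : 0 <= N := schatten_norm_ge0 _ _.
have finN : N < +oo.
  apply: le_lt_trans (schatten_normD cA'A cAA' q1) _.
  have sqr_fin x : 0 <= x -> x < +oo -> x ^+ 2 < +oo :> \bar R.
    by case: x => // x _ _; rewrite -EFin_expe ltry.
  rewrite (schatten_norm_sqr AA' p0) (schatten_norm_sqr A'A p0) lte_add_pinfty//;
    apply: sqr_fin => //; rewrite ?schatten_norm_ge0//.
  by rewrite (le_lt_trans (schatten_normC cA _))//; lra.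
have sqrRe t : schatten_norm (p / 2) (re_op (expi t \*: A)%R \o re_op (expi t \*: A)%R) =
    schatten_norm p (re_op (expi t \*: A)%R) ^+ 2.
  by rewrite (schatten_norm_sqr (proj1 (cRe t)) p0).
have le_numrad t :
    schatten_norm (p / 2) (re_op (expi t \*: A)%R \o re_op (expi t \*: A)%R)
    <= schatten_numrad p A ^+ 2.
  rewrite sqrRe !expe2; apply: lee_pmul; rewrite ?schatten_norm_ge0//;
    by apply: ereal_sup_ubound; exists t.
apply/andP; split.
  apply: ge_ereal_sup => _ [t _ <-].
  apply: lee_half_dist => //; try exact: schatten_norm_ge0.
    by rewrite (im_op_expi _ AA') le_numrad.
  (* The remaining premise bounds [N] by twice the sum of the norms of the two squares: the triangle
     inequality for D written as twice their sum. *)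
  rewrite /N (re_op_sqrD t AA') (im_op_expi _ AA').
  have r2 : rnorm (2%R : R[i]) = 2%R by rewrite -[RHS]normr_nat -rnorm_real rmorph_nat.
  have cD := compact_pairD (cRe_sqr t) (cRe_sqr (t - pi / 2)%R).
  apply: le_trans (schatten_normZ cD q1 _) _; first by rewrite r2.
  rewrite r2 lee_wpmul2l ?lee_fin//; exact: schatten_normD.
have V0 : 0 <= schatten_numrad (p / 2) (A \o A).
  apply: le_trans (schatten_norm_ge0 _ _) _; last by apply: ereal_sup_ubound; exists 0%R.
(* The upper bound is proved in additive form, where an infinite [schatten_numrad (p / 2) (A \o A)]
   makes it trivial; the finite [N] is subtracted only at the end. *)
have W2 : schatten_numrad p A ^+ 2 <=
    (2^-1)%:E * schatten_numrad (p / 2) (A \o A) + (4^-1)%:E * N.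
  have half (n : nat) : (rnorm (n.+1%:R^-1 : R[i]) = n.+1%:R^-1 :> R)%R.
    by rewrite rnormV -[in RHS]normr_nat -rnorm_real rmorph_nat.
  have Re_le t : schatten_norm p (re_op (expi t \*: A)%R) ^+ 2 <=
      (2^-1)%:E * schatten_numrad (p / 2) (A \o A) + (4^-1)%:E * N.
    rewrite -sqrRe (re_op_sqr t AA').
    have cD := compact_pairD cA'A cAA'.
    apply: le_trans (schatten_normD (compact_pairZ _ (cRe2 _)) (compact_pairZ _ cD) q1) _.
    apply: leeD.
      apply: le_trans (schatten_normZ (cRe2 _) q1 _) _; first by rewrite half invr_gt0.
      rewrite half lee_wpmul2l ?lee_fin ?invr_ge0//.
      by apply: ereal_sup_ubound; exists (t + t)%R.
    apply: le_trans (schatten_normZ cD q1 _) _; first by rewrite half invr_gt0.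
    by rewrite half.
  move: V0 Re_le N0 finN; set V := schatten_numrad _ (A \o A).
  case: V => [v| |] // v0 Re_le; case: N Re_le => [n| |] // Re_le n0 _.
    apply: ereal_sup_sqr_le.
      by exists (schatten_norm p (re_op (expi 0 \*: A)%R)), 0%R.
      by move=> _ [t _ <-]; exact: schatten_norm_ge0.
    by move=> _ [t _ <-]; exact: Re_le.
  by rewrite mulry gtr0_sg ?invr_gt0// mul1e addye ?leey.
case: N N0 finN W2 => [n| |] // n0 _ W2.
by rewrite leeBlDr.
Qed.
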